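(* Let $q$ be a prime power, let $n$ be a positive integer, let $\pi$ be an irreducible cuspidal complex representation of $\mathrm{GL}_{3n}(\mathbb{F}_q)$, and let $\psi_0:\mathbb{F}_q\to\mathbb{C}^*$ be a nontrivial additive character. Let $N$ be the unipotent radical of the standard parabolic subgroup of type $(n,n,n)$ of $\mathrm{GL}_{3n}(\mathbb{F}_q)$, let $\psi:N\to\mathbb{C}^*$ be the character determined by $\psi_0$ as described in the context, and let $\pi_{N,\psi}$ be the corresponding twisted Jacquet module, i.e. the representation on the space of vectors $v$ of $\pi$ satisfying $\pi(u)v=\psi(u)v$ for all $u\in N$. Then $$\dim(\pi_{N,\psi})=q^{\frac{n(n-1)}{2}}\prod_{i=1}^{n-1}(q^n-q^i).$$
   Context: $\mathbb{F}_q$ is the finite field with $q$ elements. All representations are finite-dimensional and complex. An irreducible representation of $\mathrm{GL}_{m}(\mathbb{F}_q)$ is cuspidal if it has no nonzero vector fixed by the unipotent radical of any proper parabolic subgroup; irreducible cuspidal representations are those associated to regular characters $\theta$ of $\mathbb{F}_{q^m}^*$, i.e. characters whose orbit under $\mathrm{Gal}(\mathbb{F}_{q^m}/\mathbb{F}_q)$ consists of $m$ distinct characters. The group $N$ is $$N=\left\{\begin{pmatrix} I_n & X & Y\\ 0& I_n & Z\\ 0&0&I_n\end{pmatrix} : X,Y,Z\in M_n(\mathbb{F}_q)\right\}\subset \mathrm{GL}_{3n}(\mathbb{F}_q).$$ The character $\psi:N\to\mathbb{C}^*$ is defined by $$\psi\begin{pmatrix} I_n & X & Y\\ 0& I_n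 & Z\\ 0&0&I_n\end{pmatrix}=\psi_0(\mathrm{tr}(X+Z)).$$ If $\pi$ acts on $V_\pi$, then the space of $\pi_{N,\psi}$ is $$V_{\pi_{N,\psi}}=\{v\in V_\pi : \pi(u)v=\psi(u)v \text{ for all } u\in N\}.$$ It is stable under the block diagonal matrices $\mathrm{diag}(g,g,g)$, $g\in\mathrm{GL}_n(\mathbb{F}_q)$ (the stabilizer of $\psi$ in the block diagonal Levi subgroup), and this makes $\pi_{N,\psi}$ a representation of $\mathrm{GL}_n(\mathbb{F}_q)$. Here $\dim(\pi_{N,\psi})=\dim_{\mathbb{C}} V_{\pi_{N,\psi}}$. Empty products equal $1$. *)

(* Defs.v *)
From HB Require Import structures.
From mathcomp Require Import all_boot all_order all_algebra all_fingroup.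
From mathcomp Require Import mxrepresentation reals complex.

Set Implicit Arguments.
Unset Strict Implicit.
Unset Printing Implicit Defensive.

Import GRing.Theory.
Local Open Scope ring_scope.

(* The complex numbers are R[i] for R : realType. As usual for mxrepresentation,
   the space of rG is that of row vectors, g acting by v |-> v *m rG g, and
   subspaces are row spaces of matrices. The indices of a matrix in {'GL_m[F]}
   have type 'I_m.-1.+1, which is 'I_m for m > 0. *)

(* The sequence of block sizes of a standard parabolic subgroup of GL_m. *)
Definition composition (m : nat) (sh : seq nat) : bool :=
  (0%N \notin sh) && (sumn sh == m).

(* reshape_index sh i is the number of the block containing the index i; the
   condition says that g is block upper triangular with identity diagonal
   blocks. *)
Definition std_unip_radical (F : finFieldType) (m : nat) (sh : seq nat) :
    {set {'GL_m[F]}} :=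
  [set g | [forall i : 'I_m.-1.+1, forall j : 'I_m.-1.+1,
     (reshape_index sh j <= reshape_index sh i)%N ==>
       (GLval g i j == (i == j)%:R)]].

(* The parabolic subgroups are the conjugates of the standard ones, and are
   proper when there are at least two blocks. *)
Definition cuspidal (R : realType) (F : finFieldType) (m d : nat)
    (rG : mx_representation R[i] 'GL_m[F] d) : Prop :=
  forall (sh : seq nat) (x : {'GL_m[F]}),
    composition m sh -> (1 < size sh)%N ->
    rfix_mx rG (std_unip_radical F m sh :^ x) = 0.

(* A character F -> C^*; the values are nonzero because psi0 0 = 1. *)
Definition additive_character (R : realType) (F : finFieldType)
    (psi0 : F -> R[i]) : Prop :=
  psi0 0 = 1 /\ {morph psi0 : x y / x + y >-> x * y}.

Definition N3 (F : finFieldType) (n : nat) : {set {'GL_(3 * n)[F]}} :=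
  std_unip_radical F (3 * n) [:: n; n; n].

(* The n x n block in position (a, b) of a 3 x 3 block matrix, a, b < 3. *)
Definition block3 (F : finFieldType) (n : nat) (a b : nat)
    (g : {'GL_(3 * n)[F]}) : 'M[F]_n :=
  \matrix_(i < n, j < n) GLval g (inord (a * n + i)) (inord (b * n + j)).

Definition psi3 (R : realType) (F : finFieldType) (n : nat) (psi0 : F -> R[i])
    (g : {'GL_(3 * n)[F]}) : R[i] :=
  psi0 (\tr (block3 0 1 g + block3 1 2 g)).

Definition twisted_jacquet (R : realType) (F : finFieldType) (n d : nat)
    (rG : mx_representation R[i] 'GL_(3 * n)[F] d) (psi0 : F -> R[i]) :
    'M[R[i]]_d :=
  (\bigcap_(u in N3 F n) eigenspace (rG u) (psi3 psi0 u))%MS.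

(* Main.v *)
Require Import Defs.
From mathcomp Require Import all_boot all_order all_algebra all_fingroup.
From mathcomp Require Import mxrepresentation mxabelem reals complex zify.

Set Implicit Arguments.
Unset Strict Implicit.
Unset Printing Implicit Defensive.

Import GRing.Theory Num.Theory.
Local Open Scope ring_scope.

(** Write q for the order of F and m = 3n. The dimension of the twisted Jacquet
    module is the trace of the projector onto it, so it is the average over
    u in N of chi(u) psi(u)^-1, chi being the character of pi. Everything
    therefore rests on the values of chi on unipotent elements, and these
    depend only on ranks:

      chi (1 + x) = (-1)^r (q - 1) (q^2 - 1) ... (q^(m-1-r) - 1),  r = rank x,

    for x nilpotent with a zero first column ([cuspidal_trace]; the right-hand
    side is [unip_value]).

    Trace formula. On the Lie algebra of the mirabolic group, consisting of the
    block matrices x = (0 v; 0 y) with v a row, expand chi (1 + x) as a Fourier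
    series in v. Cuspidality kills the constant term, invariance under
    conjugation kills the frequencies xi with y xi <> 0, and all the other
    frequencies are conjugate to the first coordinate, where the Fourier
    coefficient is a function of the same kind in size m - 1
    ([whittaker_part_cuspfun]). The sum over the remaining frequencies is
    q^(dim ker y) - 1 if v lies in the row space of y, and - 1 if not. This is
    the recursion of [unip_value] ([cuspfunE]), up to a constant factor that
    after m - 1 steps is recognized as the dimension of the space of Whittaker
    vectors of pi ([whittakerE]).

    Multiplicity one. That dimension is 1. If e is the idempotent of the
    generic character of the unitriangular group, the anti-involution
    g |-> w0 g^T w0 fixes e pi(g) e: by the Bruhat decomposition this needs
    checking only on monomial matrices, and one with e pi(g) e <> 0 is itself
    fixed by the anti-involution ([monomial_antitranspose]). Hence these
    operators commute; as pi is irreducible they span the algebra of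
    endomorphisms of the image of e, which has dimension at most 1
    ([whittaker_rank_le1]). It is not 0, since chi (1) <> 0.

    Summation. For x in the Lie algebra of N the blocks X, Y, Z enter only
    through the rank of (X Y; 0 Z). Summing [unip_value] m against an additive
    character over one row of a matrix, the others being fixed, gives
    q^(m-1) times [unip_value] (m - 1) of the rank of the other rows, and it
    gives 0 unless these rows vanish on the frequency ([sum_rank_row],
    [unip_value_diff]). Removing 2n rows in this way leaves a power of q times
    (q - 1) ... (q^(n-1) - 1) ([sum_unip_value_nilradical3]). *)

(** * Additive characters *)

Definition nontrivial_character (F : finFieldType) (C : numFieldType)
    (psi : F -> C) : Prop :=
  [/\ psi 0 = 1, {morph psi : x y / x + y >-> x * y} & exists x, psi x != 1].

Lemma sum_in_inj (T : finType) (V : nmodType) (A : {set T}) (h : T -> T) (G : T -> V) :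
  injective h -> {in A, forall x, h x \in A} ->
  \sum_(x in A) G (h x) = \sum_(x in A) G x.
Proof.
move=> hI hA; have hAE : [set h x | x in A] = A.
  apply/eqP; rewrite eqEcard card_imset // leqnn andbT.
  by apply/subsetP => _ /imsetP[x xA ->]; exact: hA.
by rewrite -[in RHS]hAE big_imset //= => x y _ _ /hI.
Qed.

Section CharacterSums.

Variables (F : finFieldType) (C : numFieldType) (psi : F -> C).
Hypothesis psiP : nontrivial_character psi.
Local Notation q := #|F|.

Let psi0 : psi 0 = 1. Proof. by case: psiP. Qed.
Let psiD x y : psi (x + y) = psi x * psi y. Proof. by case: psiP => _ ->. Qed.

Lemma card_field_neq0 k : (q ^ k)%:R != 0 :> C.
Proof. by rewrite pnatr_eq0 expn_eq0 (cardD1 0). Qed.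

Lemma psiVN x : psi x * psi (- x) = 1.
Proof. by rewrite -psiD subrr. Qed.

Lemma nontrivial_characterN : nontrivial_character (fun x => psi (- x)).
Proof.
case: psiP => _ _ [x nx]; split=> [|a b|]; rewrite ?oppr0 ?opprD //.
by exists (- x); rewrite opprK.
Qed.

Lemma character_scale_neq1 t : t != 0 -> exists a, psi (a * t) != 1.
Proof.
by move=> t0; case: psiP => _ _ [x nx]; exists (x / t); rewrite divfK.
Qed.

(** Translation by b multiplies the sum by psi (l b). *)
Lemma sum_character0 (V : finZmodType) (A : pred V) (l : V -> F) (b : V) :
    {morph l : x y / x + y} -> (forall x, A (x + b) = A x) -> psi (l b) != 1 ->
  \sum_(x | A x) psi (l x) = 0.
Proof.
move=> lD Ab nb; set S := \sum_(x | _) _.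
have: S * psi (l b) = S.
  rewrite /S mulr_suml [RHS](reindex_inj (addIr b)) /=.
  by apply: eq_big => [x|x _]; rewrite ?Ab // lD psiD.
move/eqP; rewrite -subr_eq0 -[X in _ - X]mulr1 -mulrBr mulf_eq0 subr_eq0.
by rewrite (negbTE nb) orbF => /eqP.
Qed.

Lemma sum_character_rowspace a b (y : 'M_(a, b)) (xi : 'cV_b) :
  \sum_(v : 'rV_b | (v <= y)%MS) psi ((v *m xi) 0 0) =
  if y *m xi == 0 then (q ^ \rank y)%:R else 0.
Proof.
case: eqP => [y0 | /eqP/matrix0Pn[i [j]]].
  rewrite (eq_bigr (fun=> 1)) => [|v /submxP[w ->]].
    rewrite sumr_const -(card_rowg y); congr (_%:R).
    by apply: eq_card => v; rewrite mem_rowg.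
  by rewrite -mulmxA y0 mulmx0 mxE psi0.
rewrite ord1 => nz; have [c nc] := character_scale_neq1 nz.
apply: (@sum_character0 _ _ (fun v : 'rV_b => (v *m xi) 0 0) (c *: row i y)).
- by move=> v w; rewrite mulmxDl mxE.
- move=> v; apply/idP/idP => [h|h]; last first.
    by rewrite addmx_sub // scalemx_sub // row_sub.
  by rewrite -(addrK (c *: row i y) v) addmx_sub // eqmx_opp scalemx_sub ?row_sub.
by rewrite -scalemxAl mxE -row_mul mxE.
Qed.

Lemma sum_character_row b (xi : 'cV_b) :
  \sum_(v : 'rV_b) psi ((v *m xi) 0 0) = if xi == 0 then (q ^ b)%:R else 0.
Proof.
rewrite -[X in if X == _ then _ else _]mul1mx -[in (q ^ b)%N](mxrank1 F b).
by rewrite -sum_character_rowspace; apply: eq_bigl => v; rewrite submx1.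
Qed.

Lemma sum_character_kernel a b (y : 'M_(a, b)) (v : 'rV_b) :
  \sum_(xi : 'cV_b | y *m xi == 0) psi ((v *m xi) 0 0) =
  if (v <= y)%MS then (q ^ (b - \rank y))%:R else 0.
Proof.
rewrite (reindex_onto trmx trmx) => [|xi _]; last exact: trmxK.
rewrite -[\rank y]mxrank_tr -mxrank_ker.
have ->: (v <= y)%MS = (kermx y^T *m v^T == 0).
  apply/idP/eqP => [/submxP[w ->]|h].
    by rewrite trmx_mul mulmxA mulmx_ker mul0mx.
  rewrite submxE; apply/eqP/trmx_inj; rewrite trmx_mul trmx0.
  have /submxP[D ->] : ((cokermx y)^T <= kermx y^T)%MS.
    by apply/sub_kermxP; rewrite -trmx_mul mulmx_coker trmx0.
  by rewrite -mulmxA h mulmx0.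
rewrite -sum_character_rowspace; apply: eq_big => [xi|xi _].
  rewrite trmxK eqxx andbT; apply/eqP/sub_kermxP => h.
    by apply/trmx_inj; rewrite trmx_mul trmxK h trmx0.
  by apply/trmx_inj; rewrite trmx_mul trmxK h trmx0.
by rewrite -[v *m _]trmxK trmx_mul trmxK mxE.
Qed.

Lemma sum_character_col b (v : 'rV_b) :
  \sum_(xi : 'cV_b) psi ((v *m xi) 0 0) = if v == 0 then (q ^ b)%:R else 0.
Proof.
have := sum_character_kernel (0 : 'M_(1, b)) v; rewrite eqmx0 submx0 mxrank0 subn0 => <-.
by apply: eq_bigl => xi; rewrite mul0mx eqxx.
Qed.

Lemma rank_col_mx_row a b (v : 'rV[F]_b) (y : 'M_(a, b)) :
  \rank (col_mx v y) = (~~ (v <= y)%MS + \rank y)%N.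
Proof.
rewrite -addsmxE; case: (boolP (v <= y)%MS) => [vy | nvy] /=.
  by rewrite (addsmx_idPr vy).
rewrite mxrank_disjoint_sum.
  congr (_ + _)%N; rewrite rank_rV; case: eqP nvy => // ->.
  by rewrite sub0mx.
apply/eqP; rewrite -mxrank_eq0; case: (posnP (\rank (v :&: y))) => [//|rk].
have := mxrank_leqif_sup (capmxSl v y) => -[le].
have ->: \rank (v :&: y) = \rank v.
  apply/eqP; rewrite eqn_leq le (leq_trans _ rk) // rank_rV; exact: leq_b1.
by rewrite eqxx sub_capmx submx_refl /= (negbTE nvy).
Qed.

(** The rank of the enlarged matrix takes one value on the row space of y and
    one off it, while the sum of the character over all rows vanishes. So the
    two parts of the sum cancel up to the difference of the two values of g,
    and what is left is the character sum over the row space. *)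
Lemma sum_rank_row a b (y : 'M[F]_(a, b)) (xi : 'cV_b) (g : nat -> C) :
    xi != 0 ->
  \sum_(v : 'rV_b) g (\rank (col_mx v y)) * psi ((v *m xi) 0 0) =
  if y *m xi == 0 then
    (q ^ \rank y)%:R * (g (\rank y) - g (\rank y).+1) else 0.
Proof.
move=> xi0; have := sum_character_row xi; rewrite (negbTE xi0).
rewrite (bigID (fun v => (v <= y)%MS)) /= => /eqP; rewrite addrC addr_eq0 => /eqP Sn.
rewrite (bigID (fun v => (v <= y)%MS)) /=.
rewrite (eq_bigr (fun v => g (\rank y) * psi ((v *m xi) 0 0))) => [|v vy]; last first.
  by rewrite rank_col_mx_row vy.
rewrite -mulr_sumr.
rewrite [X in _ + X](eq_bigr (fun v => g (\rank y).+1 * psi ((v *m xi) 0 0))); last first.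
  by move=> v vy; rewrite rank_col_mx_row vy.
rewrite -mulr_sumr Sn mulrN -mulrBl sum_character_rowspace.
by case: ifP; rewrite ?mulr0 // mulrC.
Qed.

(** The value of the character of a cuspidal representation of GL_m at a
    unipotent element u with rank (u - 1) = r. *)
Definition unip_value (m r : nat) : C :=
  (-1) ^+ r * \prod_(1 <= i < m - r) ((q ^ i)%:R - 1).

(** With [unip_value_out], the recursion met when a row is added to a matrix
    of rank r, inside or outside its row space. *)
Lemma unip_value_in m r : (r <= m)%N ->
  unip_value m.+2 r = unip_value m.+1 r * ((q ^ (m.+1 - r))%:R - 1).
Proof.
move=> rm; rewrite /unip_value subSn ?big_nat_recr ?mulrA //=; last by rewrite leqW.
by rewrite subn_gt0.
Qed.

Lemma unip_value_out m r : unip_value m.+1 r.+1 = - unip_value m r.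
Proof. by rewrite /unip_value exprS mulN1r mulNr subSS. Qed.

(** The factor q^r (g r - g (r + 1)) of [sum_rank_row] for g = [unip_value],
    which turns the sum over a row into the same problem in size one less. *)
Lemma unip_value_diff m r : (r < m)%N ->
  (q ^ r)%:R * (unip_value m.+1 r - unip_value m.+1 r.+1) =
  (q ^ m)%:R * unip_value m r.
Proof.
case: m => // m; rewrite ltnS => rm.
rewrite unip_value_in // unip_value_out opprK mulrBr mulr1 subrK mulrCA mulrC.
by rewrite -natrM -expnD subnKC // leqW.
Qed.


Lemma sum_col_mx (V : nmodType) n k (G : 'M[F]_(1 + n, k) -> V) :
  \sum_A G A = \sum_(B : 'M_(n, k)) \sum_(v : 'rV_k) G (col_mx v B).
Proof.
rewrite pair_big /= (reindex (fun p : 'M_(n, k) * 'rV_k => col_mx p.2 p.1)) //=.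
exists (fun A => (dsubmx A, usubmx A)) => [[B v] _ | A _] /=.
  by rewrite col_mxKu col_mxKd.
by rewrite vsubmxK.
Qed.

Lemma sum_row_mx (V : nmodType) n k (G : 'M[F]_(n, 1 + k) -> V) :
  \sum_A G A = \sum_(B : 'M_(n, k)) \sum_(c : 'cV_n) G (row_mx c B).
Proof.
rewrite pair_big /= (reindex (fun p : 'M_(n, k) * 'cV_n => row_mx p.2 p.1)) //=.
exists (fun A => (rsubmx A, lsubmx A)) => [[B v] _ | A _] /=.
  by rewrite row_mxKl row_mxKr.
by rewrite hsubmxK.
Qed.

Lemma row_mx0A l n p (X : 'M[F]_(l, p)) :
  row_mx (0 : 'M_(l, 1 + n)) X = row_mx (0 : 'M_(l, 1)) (row_mx (0 : 'M_(l, n)) X).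
Proof.
rewrite row_mxA row_mx0.
apply/matrixP => i j; rewrite castmxE /=; congr (row_mx _ _ _ _).
  exact/val_inj.
exact/val_inj.
Qed.

(** The rows of A = (Z Y) are removed one at a time. Summing over the first row
    with frequency its first coordinate gives 0 unless the first column of the
    remaining matrix vanishes; that column can then be dropped, and (Z Y) has
    lost one row and one column of Z. *)
Lemma sum_unip_value_block n l p m (X : 'M[F]_(l, p)) : (n + p < m)%N ->
  \sum_(A : 'M_(n, n + p))
      unip_value m (\rank (col_mx A (row_mx 0 X))) * psi (\tr (lsubmx A)) =
  (q ^ (\sum_(i < n) (m - i.+1)))%:R * unip_value (m - n) (\rank X).
Proof.
elim: n m => [|n IHn] m ltm.
  rewrite big_ord0 mul1r subn0 (big_pred1 0) => [|A]; last first.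
    by apply/esym/eqP; exact: flatmx0.
  rewrite /mxtrace big_ord0 psi0 mulr1 -addsmxE (adds0mx _ _).
  by rewrite (_ : row_mx (0 : 'M_(l, 0)) X = X :> 'M_(l, p)) //; apply/matrixP=> i j;
    rewrite mxE; case: splitP => [[]|k /ord_inj ->].
case: m ltm => // m ltm1; have ltm : (n + p < m)%N := ltm1.
(* v is the first row of A, c the rest of its first column. *)
rewrite sum_col_mx (@sum_row_mx _ n (n + p)).
pose xi : 'cV[F]_(1 + (n + p)) := delta_mx 0 0.
have x0 : xi != 0.
  by apply/matrix0Pn; exists 0, 0; rewrite mxE !eqxx oner_eq0.
rewrite (eq_bigr (fun B : 'M_(n, n + p) => (q ^ m)%:R *
   (unip_value m (\rank (col_mx B (row_mx 0 X))) * psi (\tr (lsubmx B))))).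
  rewrite -mulr_sumr IHn // mulrA -natrM -expnD big_ord_recl subSS subn0 subSS.
  by congr (_%:R * _).
move=> B _.
pose X0 : 'M_(l, 1 + (n + p)) := row_mx (0 : 'M_(l, 1 + n)) X.
pose y (c : 'cV_n) : 'M_(n + l, 1 + (n + p)) := col_mx (row_mx c B) X0.
transitivity (\sum_(c : 'cV_n) psi (\tr (lsubmx B)) *
  \sum_(v : 'rV_(1 + (n + p))) unip_value m.+1 (\rank (col_mx v (y c))) *
     psi ((v *m xi) 0 0)).
  apply: eq_bigr => c _; rewrite mulr_sumr; apply: eq_bigr => v _.
  rewrite mulrCA; congr (_ * _).
    congr (unip_value _ _); rewrite /y -!addsmxE.
    rewrite -(adds_eqmx (addsmxE v (row_mx c B)) (eqmx_refl X0)).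
    rewrite -(adds_eqmx (eqmx_refl v) (addsmxE (row_mx c B) X0)).
    by rewrite addsmxA.
  rewrite mulrC -psiD; congr psi.
  rewrite /mxtrace big_ord_recl; congr (_ + _).
    rewrite !mxE (bigD1 0) //= big1 => [|i ni]; last by rewrite mxE (negbTE ni) mulr0.
    rewrite !mxE eqxx mulr1 addr0; case: splitP => // k _; rewrite ord1; congr (v _ _).
    exact/val_inj.
  apply: eq_bigr => i _; rewrite !mxE.
  case: splitP => [k|k Hk]; first by rewrite ord1.
  rewrite (_ : k = i); last by apply: val_inj; case: Hk.
  rewrite mxE; case: splitP => [j|j Hj]; first by rewrite ord1.
  by congr (B _ _); apply: val_inj; case: Hj.
transitivity (\sum_(c : 'cV_n) psi (\tr (lsubmx B)) *
   (if y c *m xi == 0 then (q ^ \rank (y c))%:R *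
      (unip_value m.+1 (\rank (y c)) - unip_value m.+1 (\rank (y c)).+1) else 0)).
  by apply: eq_bigr => c _; congr (_ * _); exact: sum_rank_row.
(* y c kills xi only for c = 0. *)
rewrite (bigD1 0) //= big1 ?addr0 => [|c nc].
  rewrite ifT; last first.
    apply/eqP/matrixP=> i j; rewrite !mxE big1 // => k _; rewrite !mxE.
    case: eqP => [->|]; last by rewrite mulr0.
    case: splitP => a _; rewrite mxE; case: splitP => b; rewrite ?mxE ?mul0r //.
  have ->: \rank (y 0) = \rank (col_mx B (row_mx 0 X)).
    by rewrite /y /X0 row_mx0A -block_mxEv block_mxEh col_mx0 rank_row_0mx.
  by rewrite unip_value_diff 1?mulrCA 1?(mulrC (psi _)) // (leq_ltn_trans (rank_leq_col _)).
rewrite ifF ?mulr0 //; apply: contraNF nc => /eqP h.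
apply/eqP/matrixP => i j; rewrite ord1 mxE.
move/matrixP: h => /(_ (lshift l i) 0); rewrite !mxE (bigD1 0) //= big1 => [|k nk].
  rewrite [xi _ _]mxE !eqxx mulr1 addr0 col_mxEu.
  by rewrite (_ : 0 = lshift (n + p) 0 :> 'I_(1 + (n + p))) ?row_mxEl //; apply: val_inj.
by rewrite [xi _ _]mxE (negbTE nk) mulr0.
Qed.

End CharacterSums.


(** * Nilradicals of parabolic subalgebras and the mirabolic Lie algebra *)
Section BlockUpper.

Variable F : finFieldType.

Definition nilpotentmx m (x : 'M[F]_m) : Prop := exists k, x ^+ k = 0.

(** beta i is the number of the block containing i. The identity gives the
    strictly upper triangular matrices, and a two-valued beta the nilradical
    of a maximal parabolic; adding 1 gives the unipotent radical. *)
Definition nilradical m (beta : 'I_m -> nat) : {set 'M[F]_m} :=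
  [set x : 'M[F]_m | [forall i, forall j, (beta j <= beta i)%N ==> (x i j == 0)]].

Lemma nilradicalP m (beta : 'I_m -> nat) (x : 'M[F]_m) :
  reflect (forall i j, (beta j <= beta i)%N -> x i j = 0) (x \in nilradical beta).
Proof.
rewrite inE; apply: (iffP forallP) => [h i j le | h i].
  by apply/eqP; move/forallP: (h i) => /(_ j)/implyP/(_ le).
by apply/forallP => j; apply/implyP => /h ->.
Qed.

Lemma nilradical0 m (beta : 'I_m -> nat) : 0 \in nilradical beta.
Proof. by apply/nilradicalP => i j _; rewrite mxE. Qed.

Lemma nilradicalD m (beta : 'I_m -> nat) x y :
  x \in nilradical beta -> y \in nilradical beta -> x + y \in nilradical beta.
Proof.
move=> /nilradicalP hx /nilradicalP hy; apply/nilradicalP => i j le.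
by rewrite mxE hx ?hy ?addr0.
Qed.

Lemma nilradicalM m (beta : 'I_m -> nat) x y :
  x \in nilradical beta -> y \in nilradical beta -> x *m y \in nilradical beta.
Proof.
move=> /nilradicalP hx /nilradicalP hy; apply/nilradicalP => i j le.
rewrite mxE big1 // => k _.
case: (leqP (beta k) (beta i)) => [/hx -> | lt]; first by rewrite mul0r.
by rewrite hy ?mulr0 // (leq_trans le) // ltnW.
Qed.

(** A nonzero entry of the k-th power leads up by at least k blocks. *)
Lemma nilradical_nilpotent m (beta : 'I_m -> nat) x : x \in nilradical beta -> nilpotentmx x.
Proof.
move/nilradicalP => hx; exists (\max_i beta i).+1.
have H k i j : (beta j < beta i + k)%N -> (x ^+ k) i j = 0.
  elim: k i j => [|k IHk] i j lt.
    rewrite expr0 mxE; case: eqP lt => // ->; by rewrite addn0 ltnn.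
  rewrite exprS -mulmxE mxE big1 // => l _.
  case: (leqP (beta l) (beta i)) => [/hx -> | lil]; first by rewrite mul0r.
  by rewrite IHk ?mulr0 // (leq_trans lt) // addnS -addSn leq_add2r.
apply/matrixP => i j; rewrite mxE H // addnS ltnS.
by apply: (leq_trans _ (leq_addl _ _)); exact: leq_bigmax.
Qed.

(** The inverse is the finite geometric series in - x. *)
Lemma nilpotentmx_unit m (x : 'M[F]_m) : nilpotentmx x -> 1%:M + x \in unitmx.
Proof.
case=> k xk0; have c1 : GRing.comm (1 : 'M[F]_m) (- x).
  by rewrite /GRing.comm mul1r mulr1.
have := subrXX_comm k c1.
rewrite exprNn xk0 mulr0 subr0 expr1n opprK => h.
by have [] := mulmx1_unit (esym h).
Qed.

Lemma nilpotentmx_conj m (x k : 'M[F]_m) :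
  k \in unitmx -> nilpotentmx x -> nilpotentmx (k *m x *m invmx k).
Proof.
move=> ku [n xn]; exists n.
have H l : (k *m x *m invmx k) ^+ l = k *m (x ^+ l) *m invmx k.
  elim: l => [|l IHl]; first by rewrite !expr0 mulmx1 mulmxV.
  by rewrite !exprS IHl -!mulmxE !mulmxA mulmxKV.
by rewrite H xn mulmx0 mul0mx.
Qed.

Lemma nilpotentmx_rank m (x : 'M[F]_m.+1) : nilpotentmx x -> (\rank x < m.+1)%N.
Proof.
case=> k xk0; rewrite ltn_neqAle rank_leq_row andbT; apply/negP => fx.
have ux : x \is a GRing.unit by rewrite -row_free_unit.
by have := unitrX k ux; rewrite xk0 unitr0.
Qed.

(** The Lie algebra of the mirabolic group fixing the first basis vector. *)
Definition mirab m (v : 'rV[F]_m) (y : 'M[F]_m) : 'M[F]_m.+1 :=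
  block_mx (0 : 'M_1) v 0 y.

Lemma mirab_dr m (v : 'rV[F]_m) y i j : mirab v y (rshift 1 i) (rshift 1 j) = y i j.
Proof. exact: (@block_mxEdr _ 1 m 1 m). Qed.

Lemma mirab_ur m (v : 'rV[F]_m) y (i : 'I_1) j : mirab v y (lshift m i) (rshift 1 j) = v 0 j.
Proof. by rewrite ord1; exact: (@block_mxEur _ 1 m 1 m). Qed.

Lemma mirab_l m (v : 'rV[F]_m) y i (j : 'I_1) : mirab v y i (lshift m j) = 0.
Proof.
rewrite -(@splitK 1 m i); case: split => i' /=.
  by rewrite /mirab (@block_mxEul _ 1 m 1 m) mxE.
by rewrite /mirab (@block_mxEdl _ 1 m 1 m) mxE.
Qed.

Lemma mirabX m (v : 'rV[F]_m) (y : 'M[F]_m) k :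
  mirab v y ^+ k.+1 = mirab (v *m y ^+ k) (y ^+ k.+1).
Proof.
elim: k => [|k IHk]; first by rewrite !expr1 expr0 mulmx1.
rewrite exprSr IHk -mulmxE /mirab (@mulmx_block _ 1 m 1 m 1 m).
rewrite !mul0mx !mulmx0 !addr0 !add0r.
by rewrite -mulmxA !mulmxE -!exprSr.
Qed.

(** Conjugation by (1 b; 0 k), the general element of the mirabolic group. The
    first column of the inverse is recorded because it ensures that the
    first coordinate of a row is unchanged by right multiplication. *)
Lemma conj_mirab m (v b : 'rV[F]_m) (y k : 'M[F]_m) : k \in unitmx ->
  exists K K' : 'M[F]_m.+1, [/\ K *m K' = 1%:M, forall i, K' i 0 = (i == 0)%:R &
    K *m mirab v y *m K' = mirab ((v + b *m y) *m invmx k) (k *m y *m invmx k)].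
Proof.
move=> ku; exists (block_mx (1%:M : 'M_1) b 0 k).
exists (block_mx (1%:M : 'M_1) (- b *m invmx k) 0 (invmx k)).
have zs := (mul0mx, mulmx0, mul1mx, mulmx1, add0r, addr0).
split=> [|i|]; last first.
- by rewrite /mirab !(@mulmx_block _ 1 m 1 m 1 m) !zs.
- rewrite (_ : 0 = lshift m (0 : 'I_1)); last exact: val_inj.
  rewrite -(@splitK 1 m i); case: (@split 1 m i) => i' /=.
    by rewrite (@block_mxEul _ 1 m 1 m) mxE ord1 !eqxx.
  by rewrite (@block_mxEdl _ 1 m 1 m) mxE.
by rewrite (@mulmx_block _ 1 m 1 m 1 m) mulmxV // !zs mulNmx addNr -scalar_mx_block.
Qed.

Lemma nilpotentmx_mirab m (v : 'rV[F]_m) (y : 'M[F]_m) :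
  nilpotentmx (mirab v y) <-> nilpotentmx y.
Proof.
split=> [[k xk]|[k yk]].
  exists k.+1; move: (congr1 (fun z => z * mirab v y) xk); rewrite -exprSr mul0r mirabX.
  move/matrixP => h; apply/matrixP => i j; move: (h (rshift 1 i) (rshift 1 j)).
  by rewrite mirab_dr !mxE.
exists k.+1; rewrite mirabX exprSr yk mulmx0 mul0r.
by rewrite /mirab block_mx0.
Qed.

Lemma rank_mirab m (v : 'rV[F]_m) (y : 'M[F]_m) :
  \rank (mirab v y) = \rank (col_mx v y).
Proof. by rewrite /mirab block_mxEh col_mx0; exact: (@rank_row_0mx F (1 + m) m 1). Qed.

(** The first column of z is 0, as no block number is below that of index 0, and
    the first row varies independently of the remaining square. *)
Lemma sum_nilradical_mirab (V : nmodType) m (beta : 'I_m.+1 -> nat) (G : 'M[F]_m.+1 -> V) :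
    (forall j : 'I_m, (beta ord0 <= beta (rshift 1 j))%N) ->
  \sum_(z in nilradical beta) G z =
  \sum_(w : 'rV_m | [forall j, (beta (rshift 1 j) <= beta ord0)%N ==> (w 0 j == 0)])
    \sum_(z in nilradical (fun j => beta (rshift 1 j))) G (mirab w z).
Proof.
move=> b0; rewrite pair_big_dep /=.
rewrite (reindex_onto (fun p : 'rV[F]_m * 'M[F]_m => mirab p.1 p.2)
   (fun z : 'M[F]_(1 + m) => (ursubmx z, drsubmx z))) /=.
  apply: eq_bigl => -[w z] /=; rewrite block_mxKur block_mxKdr eqxx andbT.
  apply/nilradicalP/andP => [h|[/forallP hw /nilradicalP hz] i j].
    split; last by apply/nilradicalP => i j le; rewrite -(mirab_dr w); exact: h.
    apply/forallP => j; apply/implyP => le.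
    rewrite -(mirab_ur w z 0 j); apply/eqP/h; apply: leq_trans le _.
    by rewrite (_ : lshift m (0 : 'I_1) = ord0) //; exact: val_inj.
  rewrite -(@splitK 1 m i) -(@splitK 1 m j).
  case: (@split 1 m j) => j' /=; first by rewrite mirab_l.
  case: (@split 1 m i) => i' /=; last by rewrite mirab_dr; exact: hz.
  rewrite mirab_ur => le; apply/eqP/(implyP (hw j')); apply: leq_trans le _.
  by rewrite (_ : lshift m i' = ord0) //; apply: val_inj; rewrite /= ord1.
move=> z /nilradicalP hz /=; apply/matrixP => i j.
rewrite -(@splitK 1 m i) -(@splitK 1 m j).
case: (@split 1 m j) => j' /=.
  rewrite mirab_l hz // (_ : lshift m j' = ord0); last by apply: val_inj; rewrite /= ord1.
  case: (@split 1 m i) => i' /=; last exact: b0.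
  by rewrite (_ : lshift m i' = ord0) //; apply: val_inj; rewrite /= ord1.
case: (@split 1 m i) => i' /=; last by rewrite mirab_dr !mxE.
by rewrite mirab_ur !mxE; congr (z _ _); apply: val_inj; rewrite /= ord1.
Qed.

End BlockUpper.

Arguments nilradical {F m} beta.

(** * Values of cuspidal characters at unipotent elements *)
Section TraceFormula.

Variables (F : finFieldType) (C : numFieldType) (psi : F -> C).
Hypothesis psiP : nontrivial_character psi.
Local Notation q := #|F|.

Let psi0 : psi 0 = 1. Proof. by case: psiP. Qed.
Let psiD x y : psi (x + y) = psi x * psi y. Proof. by case: psiP => _ ->. Qed.

Definition upper_at m (a : nat) (x : 'M[F]_m) : Prop :=
  forall i j : 'I_m, (a <= i)%N -> (j < a)%N -> x i j = 0.

(** The nilradical for the two blocks of sizes a and m - a. *)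
Definition nilradical2 m (a : nat) : {set 'M[F]_m} := nilradical (fun i : 'I_m => (a <= i)%N).

(** The properties of x |-> chi (1 + x), for a cuspidal character chi, that
    survive in its Fourier coefficients: invariance under the mirabolic group
    only, and vanishing of the sums over nilradicals. In the latter the base
    point lies in the parabolic subalgebra, so that 1 + x + z runs over a coset
    of the unipotent radical. *)
Record cuspfun m (Phi : 'M[F]_m.+1 -> C) : Prop := CuspFun {
  cuspfun_mirab : forall (v b : 'rV_m) (y k : 'M_m), k \in unitmx ->
    Phi (mirab ((v + b *m y) *m invmx k) (k *m y *m invmx k)) = Phi (mirab v y);
  cuspfun_sum : forall (a : nat) (v : 'rV_m) (y : 'M_m), (0 < a <= m)%N ->
    nilpotentmx y -> upper_at a (mirab v y) ->
    \sum_(z in nilradical2 m.+1 a) Phi (mirab v y + z) = 0 }.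

(** The Fourier coefficient at the first coordinate of the top row. On
    characters this is the Bernstein-Zelevinsky functor from representations of
    one mirabolic group to those of the next smaller one. *)
Definition whittaker_part m (Phi : 'M[F]_m.+2 -> C) (y : 'M[F]_m.+1) : C :=
  (q ^ m.+1)%:R^-1 * \sum_(v : 'rV_m.+1) Phi (mirab v y) * psi (- v 0 0).

(** The Fourier coefficient at the generic character of the unitriangular
    group, one row at a time; [whittakerE] gives it as a single sum. *)
Fixpoint whittaker m : ('M[F]_m.+1 -> C) -> C :=
  match m with
  | 0 => fun Phi => Phi 0
  | m'.+1 => fun Phi => whittaker (whittaker_part Phi)
  end.

Lemma mirabD m (v w : 'rV[F]_m) y z : mirab v y + mirab w z = mirab (v + w) (y + z).
Proof. by rewrite /mirab (@add_block_mx _ 1 m 1 m) !addr0. Qed.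

Lemma cuspfun_conj m (Phi : 'M[F]_m.+1 -> C) (v : 'rV_m) (y k : 'M_m) :
    cuspfun Phi -> k \in unitmx ->
  Phi (mirab (v *m invmx k) (k *m y *m invmx k)) = Phi (mirab v y).
Proof. by move=> cP ku; rewrite -(cuspfun_mirab cP v 0 y ku) mul0mx addr0. Qed.

Lemma cuspfun_shift m (Phi : 'M[F]_m.+1 -> C) (v b : 'rV_m) (y : 'M_m) :
  cuspfun Phi -> Phi (mirab (v + b *m y) y) = Phi (mirab v y).
Proof.
move=> cP; rewrite -(cuspfun_mirab cP v b y (unitmx1 F m)).
by rewrite invmx1 !mulmx1 mul1mx.
Qed.

Lemma whittaker_part_conj m (Phi : 'M[F]_m.+2 -> C) (K K' y : 'M[F]_m.+1) :
    cuspfun Phi -> K *m K' = 1%:M -> (forall k, K' k 0 = (k == 0)%:R) ->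
  whittaker_part Phi (K *m y *m K') = whittaker_part Phi y.
Proof.
move=> cP KK' K'0; have [Ku K'u] := mulmx1_unit KK'.
have iK : invmx K = K' by rewrite -[LHS]mulmx1 -KK' mulKmx.
congr (_ * _); rewrite [LHS](reindex_inj (can_inj (mulmxK K'u))) /=.
apply: eq_bigr => v _.
rewrite -[in X in mirab X _]iK -[in X in mirab _ X]iK (cuspfun_conj _ _ cP) //.
congr (_ * psi (- _)); rewrite mxE (bigD1 0) //= K'0 mulr1 big1 ?addr0 // => k nk.
by rewrite K'0 (negbTE nk) mulr0.
Qed.

(** Invariance passes through because the mirabolic group of the smaller size
    preserves the first coordinate of the row v. For the vanishing, the
    nilradical for blocks (a + 1, m - a) of the larger size consists of the one
    for (a, m - a) of the smaller size together with top rows whose first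
    coordinate is 0, and these do not change the character. *)
Lemma whittaker_part_cuspfun m (Phi : 'M[F]_m.+2 -> C) :
  cuspfun Phi -> cuspfun (whittaker_part Phi).
Proof.
move=> cP; split.
  move=> v b y k ku; have [K [K' [KK' K'0 <-]]] := conj_mirab v b y ku.
  exact: whittaker_part_conj.
move=> a v' y' /andP[a0 am] ny' up; set y := mirab v' y'.
have ny : nilpotentmx y by apply/nilpotentmx_mirab.
have upy v : upper_at a.+1 (mirab v y).
  move=> i j; rewrite -(@splitK 1 m.+1 i) -(@splitK 1 m.+1 j).
  case: (@split 1 m.+1 j) => j' /=; first by rewrite mirab_l.
  case: (@split 1 m.+1 i) => i' /=; first by rewrite ord1.
  by rewrite mirab_dr; exact: up.
pose W := [pred w : 'rV[F]_m.+1 |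
  [forall j, ((a.+1 <= rshift 1 j)%N <= (a.+1 <= @ord0 m.+1)%N)%N ==> (w 0 j == 0)]].
(* W is the set of top rows w of the larger nilradical. *)
have S0 : \sum_(w | W w) \sum_(z in nilradical2 m.+1 a)
    \sum_(v : 'rV_m.+1) Phi (mirab (v + w) (y + z)) * psi (- v 0 0) = 0.
  rewrite [LHS](eq_bigr (fun w => \sum_(v : 'rV_m.+1)
     \sum_(z in nilradical2 m.+1 a) Phi (mirab (v + w) (y + z)) * psi (- v 0 0))); last first.
    by move=> w _; rewrite exchange_big.
  rewrite exchange_big big1 //= => v _.
  have := @cuspfun_sum _ _ cP a.+1 v y am ny (upy v).
  rewrite /nilradical2 sum_nilradical_mirab // => h.
  transitivity (0 * psi (- v 0 0)); last by rewrite mul0r.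
  rewrite -[in RHS]h mulr_suml; apply: eq_bigr => w _; rewrite mulr_suml.
  by apply: eq_bigr => z _; rewrite mirabD.
(* The translation v := v + w leaves the character unchanged as w 0 0 = 0. *)
have S1 : \sum_(w | W w) \sum_(z in nilradical2 m.+1 a)
    (q ^ m.+1)%:R * whittaker_part Phi (y + z) = 0.
  rewrite -[RHS]S0; apply: eq_bigr => w Ww; apply: eq_bigr => z _.
  rewrite mulrA divff ?card_field_neq0 // mul1r (reindex_inj (addIr w)) /=.
  apply: eq_bigr => v _; congr (_ * psi (- _)); rewrite mxE.
  move: Ww => /= /forallP/(_ 0)/implyP/(_ _)/eqP ->; rewrite ?addr0 //.
  by rewrite addn0 ltnNge a0.
have : #|W|%:R *
    ((q ^ m.+1)%:R * \sum_(z in nilradical2 m.+1 a) whittaker_part Phi (y + z)) = 0.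
  by rewrite mulr_natl -sumr_const -[RHS]S1 mulr_sumr.
move/eqP; rewrite !mulf_eq0 (negbTE (card_field_neq0 _ _ _)) orFb orbC => /orP[/eqP // | ].
rewrite pnatr_eq0 => /eqP/card0_eq/(_ 0); rewrite !inE => /negP[].
by apply/forallP => j; rewrite mxE eqxx implybT.
Qed.


(** xi has rank 1, so its Gaussian factorization reads xi = a C e_0 with C
    invertible and a a nonzero scalar. *)
Lemma complete_column m (xi : 'cV[F]_m.+1) : xi != 0 ->
  exists2 k, k \in unitmx & k *m xi = delta_mx 0 0.
Proof.
move=> x0; have rx : \rank xi = 1%N.
  rewrite -mxrank_tr rank_rV; case: eqP => // /(congr1 trmx).
  by rewrite trmxK trmx0 => /eqP; rewrite (negbTE x0).
pose a := row_ebase xi 0 0.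
have ra : row_ebase xi = a%:M by rewrite [LHS]mx11_scalar.
have a0 : a != 0.
  have := row_ebase_unit xi; rewrite ra unitmxE det_scalar1 unitfE //.
exists (invmx (a *: col_ebase xi)).
  by rewrite unitmx_inv unitmxZ ?unitfE // col_ebase_unit.
have uC : a *: col_ebase xi \in unitmx by rewrite unitmxZ ?unitfE // col_ebase_unit.
rewrite -[X in _ *m X]mulmx_ebase ra rx mul_mx_scalar scalemxAl.
rewrite mulKmx //; apply/matrixP => i j; rewrite !mxE ord1 andbT.
by case: eqP => [/eqP|] ; rewrite -?val_eqE /=; case: i => -[|i] //=.
Qed.

Lemma fourier_inversion m (g : 'rV[F]_m -> C) (v : 'rV_m) :
  g v = (q ^ m)%:R^-1 * \sum_(xi : 'cV_m) psi ((v *m xi) 0 0) *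
     \sum_(w : 'rV_m) g w * psi (- (w *m xi) 0 0).
Proof.
rewrite (eq_bigr (fun xi => \sum_(w : 'rV_m) g w * psi (((v - w) *m xi) 0 0))).
  rewrite exchange_big (bigD1 v) //= -mulr_sumr sum_character_col // subrr eqxx.
  rewrite big1 ?addr0 => [|w nw].
    by rewrite mulrCA mulVf ?mulr1 ?card_field_neq0.
  by rewrite -mulr_sumr sum_character_col // subr_eq0 eq_sym (negbTE nw) mulr0.
move=> xi _; rewrite mulr_sumr; apply: eq_bigr => w _.
by rewrite mulrCA -psiD; congr (_ * psi _); rewrite mulmxBl !mxE.
Qed.

Lemma sum_nilradical2_1 m (G : 'M[F]_m.+1 -> C) :
  \sum_(z in nilradical2 m.+1 1) G z = \sum_(w : 'rV_m) G (mirab w 0).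
Proof.
rewrite sum_nilradical_mirab //; apply: eq_big => [w|w _].
  by apply/forallP => j.
rewrite (big_pred1 0) // => z; apply/nilradicalP/eqP => [h|->].
  by apply/matrixP => i j; rewrite mxE h.
by move=> i j _; rewrite mxE.
Qed.

Lemma upper_at1 m (v : 'rV[F]_m) y : upper_at 1 (mirab v y).
Proof.
move=> i j _; rewrite -(@splitK 1 m j).
by case: (@split 1 m j) => j' //=; rewrite mirab_l.
Qed.

Lemma mirab_of_col0 m (y : 'M[F]_m.+1) : (forall i, y i 0 = 0) ->
  y = mirab (@ursubmx _ 1 m 1 m y) (@drsubmx _ 1 m 1 m y).
Proof.
move=> y0; apply/matrixP => i j; rewrite -(@splitK 1 m i) -(@splitK 1 m j).
case: (@split 1 m j) => j' /=.
  rewrite mirab_l (_ : lshift m j' = 0) ?y0 //; apply: val_inj; rewrite /= ord1 //.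
case: (@split 1 m i) => i' /=; last by rewrite mirab_dr !mxE.
by rewrite mirab_ur !mxE; congr (y _ _); apply: val_inj; rewrite /= ord1.
Qed.

(** Induction on the size through the Fourier expansion in the top row v. The
    coefficient S xi vanishes at xi = 0 by cuspidality, and for y xi <> 0
    because adding a multiple of a row of y to v is a conjugation. For the
    remaining frequencies a conjugation moves xi to the first basis vector,
    and the coefficient is a [whittaker_part], known by induction. Nilpotency
    also gives rank y <= m, which keeps the recursion of [unip_value] in its
    range. *)
Lemma cuspfunE m (Phi : 'M[F]_m.+1 -> C) (v : 'rV_m) (y : 'M_m) :
    cuspfun Phi -> nilpotentmx y ->
  Phi (mirab v y) = unip_value F C m.+1 (\rank (mirab v y)) * whittaker Phi.
Proof.
elim: m Phi v y => [|m IHm] Phi v y cP ny.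
  have z0 : mirab v y = 0.
    apply/matrixP => i j.
    by rewrite (_ : j = lshift 0 (0 : 'I_1)) ?mirab_l ?mxE // ord1; exact: val_inj.
  by rewrite z0 mxrank0 /unip_value big_geq // expr0 !mul1r.
pose S (xi : 'cV[F]_m.+1) := \sum_(w : 'rV_m.+1) Phi (mirab w y) * psi (- (w *m xi) 0 0).
have SE (xi : 'cV[F]_m.+1) : S xi = if (xi != 0) && (y *m xi == 0) then
    (q ^ m.+1)%:R * (unip_value F C m.+1 (\rank y) * whittaker Phi) else 0.
  case: eqP => [-> | /eqP xi0] /=.
    have := @cuspfun_sum _ _ cP 1 0 y isT ny (@upper_at1 _ _ _).
    rewrite sum_nilradical2_1 => h; rewrite -[RHS]h; apply: eq_bigr => w _.
    by rewrite mirabD add0r addr0 mulmx0 mxE oppr0 psi0 mulr1.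
  case: eqP => [yx | /eqP/matrix0Pn[i [j]]].
    (* As y xi = 0, the conjugate by k has first column 0. *)
    have [k ku kx] := complete_column xi0.
    have kyk0 : forall i, (k *m y *m invmx k) i 0 = 0.
      move=> i; have: k *m y *m invmx k *m (k *m xi) = 0.
        by rewrite mulmxA mulmxKV // -mulmxA yx mulmx0.
      rewrite kx => /matrixP/(_ i 0); rewrite [X in _ = X]mxE mxE (bigD1 0) //=.
      rewrite big1 => [|l nl]; last by rewrite [X in _ * X]mxE (negbTE nl) mulr0.
      by rewrite [X in _ * X]mxE !eqxx mulr1 addr0.
    have nk := nilpotentmx_conj ku ny.
    transitivity ((q ^ m.+1)%:R * whittaker_part Phi (k *m y *m invmx k)).
      rewrite mulrA divff ?card_field_neq0 // mul1r.
      have iku : invmx k \in unitmx by rewrite unitmx_inv.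
      rewrite [RHS](reindex_inj (can_inj (mulmxK iku))) /=.
      apply: eq_bigr => w _; rewrite (cuspfun_conj _ _ cP) //; congr (_ * psi (- _)).
      rewrite -[in LHS](mulKmx ku xi) kx mulmxA mxE (bigD1 0) //= big1 => [|l nl].
        by rewrite [X in _ * X]mxE !eqxx mulr1 addr0.
      by rewrite [X in _ * X]mxE (negbTE nl) mulr0.
    congr (_ * _); rewrite (mirab_of_col0 kyk0) in nk *.
    rewrite IHm; last 2 first.
    - exact: whittaker_part_cuspfun.
    - by apply/nilpotentmx_mirab; exact: nk.
    rewrite -(mirab_of_col0 kyk0) /=; congr (unip_value _ _ _ _ * _).
    rewrite mxrankMfree; last by rewrite row_free_unit unitmx_inv.
    by rewrite -mxrank_tr trmx_mul mxrankMfree ?row_free_unit ?unitmx_tr // mxrank_tr.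
  rewrite ord1 => nz; have [c nc] := character_scale_neq1 (nontrivial_characterN psiP) nz.
  (* The i-th entry of y xi is nonzero; translate by a multiple of row i. *)
  pose b := c *: (delta_mx 0 i : 'rV[F]_m.+1) *m y.
  have Sb : S xi * psi (- (b *m xi) 0 0) = S xi.
    rewrite /S mulr_suml [RHS](reindex_inj (addIr b)) /=.
    apply: eq_bigr => w _; rewrite (cuspfun_shift _ _ _ cP) -mulrA -psiD.
    by congr (_ * psi _); rewrite mulmxDl !mxE opprD.
  move/eqP: Sb; rewrite -subr_eq0 -[X in _ - X]mulr1 -mulrBr mulf_eq0 subr_eq0.
  case/orP=> /eqP // h; case/eqP: nc; rewrite -h; congr (psi (- _)).
  by rewrite /b -mulmxA -scalemxAl -rowE !mxE.
rewrite [LHS](fourier_inversion (fun w => Phi (mirab w y))).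
rewrite (eq_bigr (fun xi => if (xi != 0) && (y *m xi == 0) then psi ((v *m xi) 0 0) *
    ((q ^ m.+1)%:R * (unip_value F C m.+1 (\rank y) * whittaker Phi)) else 0)); last first.
  by move=> xi _; rewrite -/(S xi) SE; case: ifP; rewrite ?mulr0.
rewrite -big_mkcond -mulr_suml mulrCA mulKf ?card_field_neq0 //.
have ry := nilpotentmx_rank ny.
have := sum_character_kernel psiP y v; rewrite (bigD1 0) /=; last by rewrite mulmx0.
rewrite mulmx0 mxE psi0 => /eqP; rewrite addrC eq_sym -subr_eq => /eqP Sk.
under eq_bigl do rewrite andbC.
rewrite -Sk mulrA; congr (_ * _); rewrite rank_mirab rank_col_mx_row.
case: (v <= y)%MS => /=.
  by rewrite add0n unip_value_in // mulrC.
by rewrite add1n unip_value_out sub0r mulN1r.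
Qed.

End TraceFormula.

(** * Whittaker vectors and averaging projectors *)

(** The logarithm of the generic character of the unitriangular group. *)
Definition superdiag (F : finFieldType) m (x : 'M[F]_m) : F :=
  \sum_(i < m) \sum_(j < m | j == i.+1 :> nat) x i j.

Lemma superdiagD (F : finFieldType) m : {morph @superdiag F m : x y / x + y}.
Proof.
move=> x y; rewrite /superdiag -big_split; apply: eq_bigr => i _ /=.
by rewrite -big_split; apply: eq_bigr => j _; rewrite mxE.
Qed.

Lemma superdiagM (F : finFieldType) m :
  {in nilradical (@nat_of_ord m) &, forall x y : 'M[F]_m, superdiag (x *m y) = 0}.
Proof.
move=> x y /nilradicalP xs /nilradicalP ys; rewrite /superdiag big1 // => i _.
rewrite big1 // => j ji; rewrite mxE big1 // => k _.
case: (leqP k i) => [ki | ik]; first by rewrite xs ?mul0r.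
by rewrite ys ?mulr0 // (eqP ji).
Qed.

Section WhittakerSum.

Variables (F : finFieldType) (C : numFieldType) (psi : F -> C).
Hypothesis psiP : nontrivial_character psi.
Local Notation q := #|F|.

Let psi0 : psi 0 = 1. Proof. by case: psiP. Qed.
Let psiD x y : psi (x + y) = psi x * psi y. Proof. by case: psiP => _ ->. Qed.

Definition strict_upper m : {set 'M[F]_m} := nilradical (@nat_of_ord m).

Lemma superdiag_mirab m (v : 'rV[F]_m.+1) (y : 'M_m.+1) :
  superdiag (mirab v y) = v 0 0 + superdiag y.
Proof.
rewrite /superdiag big_ord_recl /=; congr (_ + _).
  rewrite (big_pred1 (rshift 1 0)); last by move=> j; rewrite /= -val_eqE.
  by rewrite -(mirab_ur v y 0 0); congr (mirab v y _ _); apply: val_inj.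
apply: eq_bigr => i _; rewrite big_mkcond big_ord_recl /= add0r -big_mkcond /=.
apply: eq_big => [j|j _]; first by rewrite eqSS.
by rewrite -(mirab_dr v y); congr (mirab v y _ _); apply: val_inj.
Qed.

Lemma sum_strict_upper m (V : nmodType) (G : 'M[F]_m.+1 -> V) :
  \sum_(x in strict_upper m.+1) G x =
  \sum_(v : 'rV_m) \sum_(y in strict_upper m) G (mirab v y).
Proof.
rewrite sum_nilradical_mirab //; apply: eq_big => [v|v _].
  by apply/forallP => j.
apply: eq_bigl => y; rewrite /strict_upper.
by apply/nilradicalP/nilradicalP => h i j le; apply: h.
Qed.

(** The top rows of a strictly upper triangular matrix are summed first in the
    recursion of [whittaker], each against its superdiagonal entry. *)
Lemma whittakerE m (Phi : 'M[F]_m.+1 -> C) :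
  whittaker psi Phi = #|strict_upper m.+1|%:R^-1 *
    \sum_(x in strict_upper m.+1) Phi x * psi (- superdiag x).
Proof.
elim: m Phi => [|m IHm] Phi /=.
  have S0 : strict_upper 1 = [set 0].
    apply/setP => x; rewrite in_set1; apply/nilradicalP/eqP => [h|-> i j _].
      by apply/matrixP => i j; rewrite !ord1 mxE h.
    by rewrite mxE.
  rewrite S0 cards1 big_set1 invr1 mul1r /superdiag.
  by rewrite big1 ?oppr0 ?psi0 ?mulr1 // => i _; rewrite big1 // => j _; rewrite mxE.
have card_su : #|strict_upper m.+2| = (q ^ m.+1 * #|strict_upper m.+1|)%N.
  rewrite -[LHS]sum1_card (@sum_strict_upper _ nat) sum_nat_const.
  by rewrite sum1_card cardT -cardE card_mx mul1n.
rewrite IHm card_su natrM invfM [RHS]mulrAC [RHS]mulrC; congr (_ * _).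
rewrite [in RHS]sum_strict_upper [in RHS]exchange_big /= mulr_sumr; apply: eq_bigr => y _.
rewrite /whittaker_part -mulrA; congr (_ * _); rewrite mulr_suml.
apply: eq_bigr => v _; rewrite -mulrA -psiD; congr (_ * psi _).
by rewrite superdiag_mirab opprD.
Qed.

End WhittakerSum.

Section Idempotents.

Variables (C : numFieldType) (d : nat) (e : 'M[C]_d).
Hypothesis ee : e *m e = e.

(** In e e = e, written with a rank factorization of e, the outer factors are
    left and right invertible and can be cancelled. *)
Lemma idempotent_factor : exists (L : 'M_(d, \rank e)) (D : 'M_(\rank e, d)),
  L *m D = e /\ D *m L = 1%:M.
Proof.
exists (col_base e), (row_base e); split; first exact: mulmx_base.
have := mulmx_base e; have /row_fullP[L] := col_base_full e.
have /row_freeP[D] := row_base_free e.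
move: (col_base e) (row_base e) => cb rb rbD Lcb cr.
have E : cb *m rb *m (cb *m rb) = cb *m rb by rewrite cr ee.
have := congr1 (fun X => L *m X *m D) E; rewrite /= !mulmxA Lcb !mul1mx.
by rewrite -!mulmxA rbD !mulmx1.
Qed.

Lemma trace_idempotent : \tr e = (\rank e)%:R.
Proof.
have [L [D [LD DL]]] := idempotent_factor.
by rewrite -[X in \tr X]LD mxtrace_mulC DL mxtrace1.
Qed.

(** The corner e M_d e is a matrix algebra of size rank e, which is commutative
    only in size at most 1. *)
Lemma rank_commutative_corner :
    (forall X Y : 'M_d, e *m X *m e *m Y *m e = e *m Y *m e *m X *m e) ->
  (\rank e <= 1)%N.
Proof.
move=> comm; rewrite leqNgt; apply/negP => r2.
have [L [D [LD DL]]] := idempotent_factor.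
have cXY (X Y : 'M[C]_(\rank e)) : X *m Y = Y *m X.
  have eL : e *m L = L by rewrite -[X in X *m _ = _]LD -mulmxA DL mulmx1.
  have De : D *m e = D by rewrite -[X in _ *m X = _]LD mulmxA DL mul1mx.
  have H X1 Y1 : D *m (e *m (L *m X1 *m D) *m e *m (L *m Y1 *m D) *m e) *m L = X1 *m Y1.
    rewrite !mulmxA De DL mul1mx -!mulmxA eL DL mulmx1 (mulmxA e) eL.
    by rewrite (mulmxA D L) DL mul1mx.
  by have := H X Y; rewrite comm H => ->.
pose i0 := Ordinal (ltnW r2); pose i1 := Ordinal r2.
have /matrixP/(_ i0 i0) := cXY (delta_mx i0 i1) (delta_mx i1 i0).
by rewrite !mul_delta_mx !mxE !eqxx /= => /eqP; rewrite oner_eq0.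
Qed.

End Idempotents.

Section Averages.

Variables (F : finFieldType) (C : numFieldType) (psi : F -> C).
Hypothesis psiP : nontrivial_character psi.

Let psi0 : psi 0 = 1. Proof. by case: psiP. Qed.
Let psiD x y : psi (x + y) = psi x * psi y. Proof. by case: psiP => _ ->. Qed.

Variables (m d : nat) (rho : 'M[F]_m -> 'M[C]_d).
Hypothesis rhoM : forall A B, rho (A *m B) = rho A *m rho B.

(* lam vanishes on products, so 1 + x |-> psi (lam x) is a character of the
   group 1 + nilradical beta. *)
Variables (beta : 'I_m -> nat) (lam : 'M[F]_m -> F).
Hypothesis lamD : {morph lam : x y / x + y}.
Hypothesis lamM : {in nilradical beta &, forall x y, lam (x *m y) = 0}.

(** The projector onto the vectors on which that group acts through that
    character. *)
Definition average : 'M[C]_d :=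
  #|@nilradical F m beta|%:R^-1 *: \sum_(x in nilradical beta) psi (- lam x) *: rho (1%:M + x).

Lemma card_nilradical_neq0 : #|@nilradical F m beta|%:R != 0 :> C.
Proof.
by rewrite pnatr_eq0 -lt0n card_gt0; apply/set0Pn; exists 0; exact: nilradical0.
Qed.

Lemma average_mulr y : y \in nilradical beta ->
  average *m rho (1%:M + y) = psi (lam y) *: average.
Proof.
move=> yL; rewrite /average -scalemxAl scalerA mulrC -scalerA; congr (_ *: _).
have uy := nilpotentmx_unit (nilradical_nilpotent yL).
have hI : injective (fun x => x *m (1%:M + y) + y).
  by move=> a b /addIr /(can_inj (mulmxK uy)).
rewrite -[in RHS](sum_in_inj _ hI); last first.
  by move=> x xL; rewrite mulmxDr mulmx1 !nilradicalD // nilradicalM.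
rewrite mulmx_suml scaler_sumr; apply: eq_bigr => x xL.
rewrite -scalemxAl -rhoM scalerA -psiD; congr (psi _ *: rho _).
  rewrite mulmxDr mulmx1 !lamD lamM // addr0.
  by rewrite opprD addrCA subrr addr0.
by rewrite mulmxDl mul1mx -addrA (addrC y).
Qed.

Lemma average_mull y : y \in nilradical beta ->
  rho (1%:M + y) *m average = psi (lam y) *: average.
Proof.
move=> yL; rewrite /average -scalemxAr scalerA mulrC -scalerA; congr (_ *: _).
have uy := nilpotentmx_unit (nilradical_nilpotent yL).
have hI : injective (fun x => (1%:M + y) *m x + y).
  by move=> a b /addIr /(can_inj (mulKmx uy)).
rewrite -[in RHS](sum_in_inj _ hI); last first.
  by move=> x xL; rewrite mulmxDl mul1mx !nilradicalD // nilradicalM.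
rewrite mulmx_sumr scaler_sumr; apply: eq_bigr => x xL.
rewrite -scalemxAr -rhoM scalerA -psiD; congr (psi _ *: rho _).
  rewrite mulmxDl mul1mx !lamD lamM // addr0.
  by rewrite opprD addrCA subrr addr0.
by rewrite mulmxDr mulmx1 -addrA (addrC y).
Qed.

Lemma average_fixed k (v : 'M_(k, d)) :
    {in nilradical beta, forall x, v *m rho (1%:M + x) = psi (lam x) *: v} ->
  v *m average = v.
Proof.
move=> h; rewrite /average -scalemxAr mulmx_sumr.
rewrite (eq_bigr (fun=> v)) => [|x xL].
  by rewrite sumr_const -scaler_nat scalerA mulVf ?scale1r ?card_nilradical_neq0.
by rewrite -scalemxAr h // scalerA -psiD addNr psi0 scale1r.
Qed.

Lemma average_idempotent : average *m average = average.
Proof. by apply: average_fixed => x xL; exact: average_mulr. Qed.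

(** The rank of an idempotent is its trace. *)
Lemma rank_average : (\rank average)%:R =
  #|@nilradical F m beta|%:R^-1 *
    \sum_(x in nilradical beta) \tr (rho (1%:M + x)) * psi (- lam x).
Proof.
rewrite -trace_idempotent; last exact: average_idempotent.
rewrite /average mxtraceZ raddf_sum /=; congr (_ * _).
by apply: eq_bigr => x _; rewrite mxtraceZ mulrC.
Qed.

End Averages.

Section CuspidalCharacter.

Variables (F : finFieldType) (C : numFieldType).
Variables (m d : nat) (rho : 'M[F]_m.+1 -> 'M[C]_d).
Hypothesis rhoM : forall A B, rho (A *m B) = rho A *m rho B.
Hypothesis rho_cusp : forall a, (0 < a <= m)%N ->
  \sum_(z in nilradical2 F m.+1 a) rho (1%:M + z) = 0.

Lemma trace_conj K K' A : K *m K' = 1%:M -> \tr (rho (K *m A *m K')) = \tr (rho A).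
Proof.
move=> KK'; have K'K := mulmx1C KK'.
by rewrite rhoM mxtrace_mulC -rhoM mulmxA K'K mul1mx.
Qed.

(** If x lies in a parabolic subalgebra with nilradical n and 1 + x is
    invertible, then x + n = x + (1 + x) n, so the sum over n of
    rho (1 + x + z) is rho (1 + x) times a sum that is 0. *)
Lemma cuspidal_cuspfun : cuspfun (fun x => \tr (rho (1%:M + x))).
Proof.
have conj1 K K' x : K *m K' = 1%:M ->
    \tr (rho (1%:M + K *m x *m K')) = \tr (rho (1%:M + x)).
  move=> KK'; rewrite -[RHS](trace_conj _ KK') mulmxDr mulmx1 mulmxDl KK' //.
split.
  by move=> v b y k ku; have [K [K' [KK' _ <-]]] := conj_mirab v b y ku; exact: conj1.
move=> a v y am ny up; set x := mirab v y.
have uy : 1%:M + x \in unitmx by apply/nilpotentmx_unit/nilpotentmx_mirab.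
pose h (z : 'M[F]_m.+1) := (1%:M + x) *m z.
have hI : injective h := can_inj (mulKmx uy).
rewrite -(sum_in_inj _ hI) => [|z /nilradicalP zL].
  transitivity (\tr (rho (1%:M + x) *m \sum_(z in nilradical2 F m.+1 a) rho (1%:M + z))).
    rewrite mulmx_sumr raddf_sum /=; apply: eq_bigr => z _.
    by rewrite -rhoM mulmxDr mulmx1 addrA.
  by rewrite rho_cusp // mulmx0 mxtrace0.
apply/nilradicalP => i j le; rewrite mxE big1 // => k _.
case: (leqP (a <= j)%N (a <= k)%N) => [/zL-> | ]; first by rewrite mulr0.
case: (leqP a j) le; case: (leqP a k) => // ka _; case: (leqP a i) => // ai _ _.
rewrite mxE [X in _ + X](up i k ai ka) addr0 mxE; case: eqP => [ik|]; last by rewrite mul0r.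
by move: ka; rewrite -ik ltnNge ai.
Qed.

End CuspidalCharacter.

(** * Bijections of an interval descending by at most one *)
Section DescentByOne.
Local Open Scope nat_scope.

Variables (T : Type) (m : nat) (f : nat -> nat) (D : nat -> T).
Hypothesis f_lt : forall k, k < m -> f k < m.
Hypothesis f_inj : forall k l, k < m -> l < m -> f k = f l -> k = l.
Hypothesis f_surj : forall y, y < m -> exists2 x, x < m & f x = y.
Hypothesis f_step : forall k, k.+1 < m -> f k.+1 < f k ->
  f k = (f k.+1).+1 /\ D k = D k.+1.

(** From a cut i, meaning that f preserves [0, i), f decreases by one at each
    step from its value f i until it reaches i. If it went up earlier, say instead
    of taking the value f i - t - 1, it would jump above f i, and in order to take
    that value later it would have to come down through f i a second time. *)
Lemma descent_run i : i < m -> i <= f i ->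
    (forall k, k < i -> f k < i) ->
  forall t, i + t <= f i -> f (i + t) = f i - t /\ D (i + t) = D i.
Proof.
move=> im ifi cut; have am := f_lt im.
suff H t : i + t <= f i -> forall s, s <= t -> f (i + s) = f i - s /\ D (i + s) = D i.
  by move=> t it; exact: (H t it t).
elim: t => [|t IHt] it s st.
  by have -> : s = 0 by [lia]; rewrite addn0 subn0.
have {}IHt := IHt ltac:(lia).
case: (leqP s t) => [/IHt // | ts]; have -> : s = t.+1 by lia.
have [ft Dt] := IHt t (leqnn t); rewrite addnS.
have it1m : (i + t).+1 < m by lia.
case: (ltnP (f (i + t).+1) (f (i + t))) => [/(f_step it1m)[f1 <-] | ge].
  by split=> //; lia.
have gta : f i < f (i + t).+1.
  rewrite ltnNge; apply/negP => le.
  have := IHt (f i - f (i + t).+1) ltac:(lia) => -[E _].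
  have E2 : f (i + (f i - f (i + t).+1)) = f (i + t).+1 by lia.
  have jm : i + (f i - f (i + t).+1) < m by lia.
  by have := f_inj jm it1m E2; lia.
have [p pm fp] : exists2 p, p < m & f p = f i - t.+1 by apply: f_surj; lia.
have walk l : (i + t).+1 + l < m -> f i < f ((i + t).+1 + l).
  elim: l => [|l IHl]; first by rewrite addn0.
  rewrite addnS => lm; have {}IHl := IHl (ltnW lm).
  rewrite ltnNge; apply/negP => le.
  have [E _] := f_step lm ltac:(lia).
  have E2 : f ((i + t).+1 + l).+1 = f i by lia.
  by have := f_inj lm im E2; lia.
have ip : i <= p by rewrite leqNgt; apply/negP => /cut; lia.
case: (leqP (i + t).+1 p) => h.
  by have := walk (p - (i + t).+1); rewrite subnKC // fp => /(_ pm); lia.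
by have [] := IHt (p - i) ltac:(lia); rewrite subnKC // fp; lia.
Qed.

(** Such a bijection reverses consecutive intervals, so it is an involution;
    D is constant on each of them. The interval starting at a cut i ends at
    f i, and f i + 1 is the next cut. *)
Lemma descent_involution k : k < m -> f (f k) = k /\ D (f k) = D k.
Proof.
suff H n i : m - i <= n -> (forall k, k < i -> [/\ f k < i, f (f k) = k & D (f k) = D k]) ->
    forall k, k < m -> f (f k) = k /\ D (f k) = D k.
  by apply: (H m 0) => //; rewrite subn0.
elim: n i => [|n IHn] i mi cut l lm.
  by have [] := cut l ltac:(lia).
case: (ltnP l i) => [/cut[]// | il].
have im : i < m by lia.
have ifi : i <= f i.
  rewrite leqNgt; apply/negP => lt; have [lt2 E _] := cut _ lt.
  have := f_inj (f_lt (f_lt im)) im E; lia.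
have am := f_lt im.
have run := descent_run im ifi (fun k ki => let: And3 h _ _ := cut k ki in h).
apply: (IHn (f i).+1) => //; first by lia.
move=> j ja; case: (ltnP j i) => [/cut[h1 h2 h3] | ij]; first by split=> //; lia.
have [] := run (j - i) ltac:(lia); rewrite subnKC // => fj Dj.
have [] := run (f i - j) ltac:(lia).
have -> : i + (f i - j) = f j by lia.
move=> ffj Dfj; split; [lia | lia | by rewrite Dfj Dj].
Qed.

End DescentByOne.

(** * Bruhat decomposition and uniqueness of Whittaker vectors *)
Section Bruhat.

Variables (F : finFieldType) (m : nat).
Implicit Types (A B : 'M[F]_m) (x y : 'M[F]_m).
Local Notation su := (strict_upper F m).

Definition isolated A (j : 'I_m) : Prop := exists i : 'I_m,
  [/\ A i j != 0, forall i', i' != i -> A i' j = 0 & forall j', j' != j -> A i j' = 0].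

Lemma strict_upperP x :
  reflect (forall i j : 'I_m, (j <= i)%N -> x i j = 0) (x \in su).
Proof. exact: nilradicalP. Qed.

Lemma mul1p_strict_upper x y : x \in su -> y \in su ->
  exists2 z, z \in su & (1%:M + x) *m (1%:M + y) = 1%:M + z.
Proof.
move=> xs ys; exists (x + y + x *m y); first by rewrite !nilradicalD // nilradicalM.
by rewrite mulmxDr mulmx1 mulmxDl mul1mx !addrA.
Qed.

Lemma strict_upper_unit x : x \in su -> 1%:M + x \in unitmx.
Proof. by move=> xs; apply/nilpotentmx_unit/(nilradical_nilpotent xs). Qed.

(** Gaussian elimination respecting the order of rows and columns. The pivot of
    column k is its lowest nonzero entry, in row p: it clears the entries of
    column k above it by row operations, then the entries of row p to its right
    by column operations. The isolated columns are untouched, since row p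
    vanishes there. *)
Lemma bruhat_step A k : A \in unitmx -> (forall j : 'I_m, (j < k)%N -> isolated A j) ->
  (k < m)%N -> exists x y, [/\ x \in su, y \in su &
    forall j : 'I_m, (j < k.+1)%N -> isolated ((1%:M + x) *m A *m (1%:M + y)) j].
Proof.
move=> uA iso km; pose k0 := Ordinal km.
have [p0 Ap0] : exists i, A i k0 != 0.
  apply/existsP; apply: contraT; rewrite negb_exists => /forallP A0.
  have : A *m (delta_mx k0 0 : 'cV_m) = 0.
    by rewrite -colE; apply/matrixP => i j; rewrite !mxE; apply/eqP; rewrite -[_ == _]negbK A0.
  move/(congr1 (mulmx (invmx A))); rewrite mulKmx // mulmx0 => /matrixP/(_ k0 0).
  by rewrite !mxE !eqxx => /eqP; rewrite oner_eq0.
pose p := [arg max_(i > p0 | A i k0 != 0) i].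
have [Ap pmax] : A p k0 != 0 /\ forall i : 'I_m, (p < i)%N -> A i k0 = 0.
  rewrite /p; case: arg_maxnP => // i Ai imax; split=> // j ij.
  by apply/eqP; apply: contraTT ij => /imax; rewrite -leqNgt.
have Apj (j : 'I_m) : (j < k)%N -> A p j = 0.
  move=> jk; have [i [Aij Ai' Aj']] := iso j jk.
  apply: Ai'; apply: contraNneq Ap => ->; apply/eqP/Aj'.
  by rewrite -val_eqE /= gtn_eqF.
pose c : 'cV[F]_m := \col_i (if (i < p)%N then - (A i k0 / A p k0) else 0).
pose r : 'rV[F]_m := \row_l (if (k0 < l)%N then - (A p l / A p k0) else 0).
pose x := c *m delta_mx 0 p; pose y := delta_mx k0 0 *m r.
exists x, y.
have xE i l : x i l = if l == p then c i 0 else 0.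
  by rewrite mxE big_ord1 [X in _ * X]mxE eqxx /=; case: eqP; rewrite ?mulr1 ?mulr0.
have yE i l : y i l = if i == k0 then r 0 l else 0.
  by rewrite mxE big_ord1 [X in X * _]mxE eqxx andbT; case: eqP; rewrite ?mul1r ?mul0r.
have BE i l : ((1%:M + x) *m A) i l = A i l + c i 0 * A p l.
  by rewrite mulmxDl mul1mx mxE -mulmxA -rowE [X in _ + X]mxE big_ord1 [X in _ * X]mxE.
set B := _ *m A in BE *.
have EE i l : (B *m (1%:M + y)) i l = B i l + B i k0 * r 0 l.
  by rewrite mulmxDr mulmx1 mxE mulmxA -colE [X in _ + X]mxE big_ord1 [X in X * _]mxE.
have Bk i : B i k0 = if i == p then A p k0 else 0.
  rewrite BE mxE; case: (ltngtP i p) => [ip | pi | /val_inj ->].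
  - by rewrite mulNr divfK // subrr -val_eqE ltn_eqF.
  - by rewrite pmax // mul0r addr0 -val_eqE gtn_eqF.
  - by rewrite eqxx mul0r addr0.
have Bp l : B p l = A p l by rewrite BE mxE ltnn mul0r addr0.
split.
- apply/strict_upperP => i j ji; rewrite xE; case: eqP => // jp.
  by rewrite mxE ltnNge -jp ji.
- apply/strict_upperP => i j ji; rewrite yE; case: eqP => // ik.
  by rewrite mxE ltnNge -ik ji.
move=> j; rewrite ltnS leq_eqVlt => /predU1P[jk | jk].
  have -> : j = k0 by apply: val_inj.
  have rk : r 0 k0 = 0 by rewrite mxE ltnn.
  exists p; split=> [|i ip|l lk].
  - by rewrite EE rk mulr0 addr0 Bk eqxx.
  - by rewrite EE rk mulr0 addr0 Bk (negbTE ip).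
  rewrite EE Bk eqxx Bp mxE; case: ltnP => [_ | lk0].
    by rewrite mulrN mulrCA divff // mulr1 subrr.
  rewrite mulr0 addr0 Apj // ltn_neqAle lk0 andbT.
  by move: lk; rewrite -val_eqE.
have Ej i : (B *m (1%:M + y)) i j = A i j.
  by rewrite EE BE Apj // mulr0 addr0 [r _ _]mxE ltnNge ltnW //= mulr0 addr0.
have [i [Aij Ai' Aj']] := iso j jk.
have jk0 : k0 != j by rewrite -val_eqE /= gtn_eqF.
have ip : i != p by apply: contraNneq Ap => <-; rewrite Aj'.
exists i; split=> [|i' ii'|l lj]; rewrite ?Ej //; first exact: Ai'.
rewrite EE Bk (negbTE ip) mul0r addr0 BE Aj' // mxE Aj' //.
by rewrite mul0r oppr0 if_same mul0r addr0.
Qed.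

Definition monomial_mx (w : 'I_m -> 'I_m) (D : 'I_m -> F) : 'M[F]_m :=
  \matrix_(i, j) (if i == w j then D j else 0).

Lemma bruhat A : A \in unitmx -> exists x y w D,
  [/\ x \in su, y \in su, injective w, forall j, D j != 0 &
      (1%:M + x) *m A *m (1%:M + y) = monomial_mx w D].
Proof.
move=> uA.
suff H k : (k <= m)%N -> exists x y, [/\ x \in su, y \in su &
    forall j : 'I_m, (j < k)%N -> isolated ((1%:M + x) *m A *m (1%:M + y)) j].
  have [x [y [xs ys iso]]] := H m (leqnn m); set M := _ *m (1%:M + y) in iso *.
  have {}iso j : isolated M j by apply: iso.
  have [w wP] := fin_all_exists iso.
  exists x, y, w, (fun j => M (w j) j); split=> //.
  - move=> j j' ww; apply/eqP; apply: contraT => jj'; have [nz _ _] := wP j.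
    by have [_ _ /(_ j jj')] := wP j'; rewrite -ww => /eqP; rewrite (negbTE nz).
  - by move=> j; have [] := wP j.
  apply/matrixP => i j; rewrite [RHS]mxE; case: (i =P w j) => [-> // | /eqP ni].
  by have [_ h _] := wP j; exact: h.
elim: k => [|k IHk] km.
  by exists 0, 0; split=> //; exact: nilradical0.
have [x [y [xs ys iso]]] := IHk (ltnW km).
have uM : (1%:M + x) *m A *m (1%:M + y) \in unitmx.
  by rewrite !unitmx_mul uA !strict_upper_unit.
have [x' [y' [x's y's iso']]] := bruhat_step uM iso km.
have [x2 x2s x2E] := mul1p_strict_upper x's xs.
have [y2 y2s y2E] := mul1p_strict_upper ys y's.
exists x2, y2; split=> //; rewrite -x2E -y2E.
by move: iso'; rewrite !mulmxA.
Qed.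

(** g |-> w0 g^T w0, an anti-automorphism preserving the unitriangular group and
    its generic character. *)
Definition antitranspose A : 'M[F]_m := \matrix_(i, j) A (rev_ord j) (rev_ord i).

Lemma antitransposeK : involutive antitranspose.
Proof. by move=> A; apply/matrixP => i j; rewrite !mxE !rev_ordK. Qed.

Lemma antitransposeD A B : antitranspose (A + B) = antitranspose A + antitranspose B.
Proof. by apply/matrixP => i j; rewrite !mxE. Qed.

Lemma antitransposeM A B :
  antitranspose (A *m B) = antitranspose B *m antitranspose A.
Proof.
apply/matrixP => i j; rewrite !mxE (reindex_inj rev_ord_inj) /=.
by apply: eq_bigr => k _; rewrite !mxE mulrC.
Qed.

Lemma antitranspose1 : antitranspose 1%:M = 1%:M.
Proof.
by apply/matrixP => i j; rewrite !mxE (inj_eq rev_ord_inj) eq_sym.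
Qed.

Lemma antitranspose_strict_upper x : x \in su -> antitranspose x \in su.
Proof.
move=> /strict_upperP xs; apply/strict_upperP => i j ji; rewrite mxE xs //=.
by apply: leq_sub2l; rewrite ltnS.
Qed.

Lemma superdiag_antitranspose x : superdiag (antitranspose x) = superdiag x.
Proof.
rewrite /superdiag (exchange_big_dep xpredT) //= (reindex_inj rev_ord_inj) /=.
apply: eq_bigr => i _; rewrite (reindex_inj rev_ord_inj) /=.
apply: eq_big => [j|j _]; last by rewrite mxE !rev_ordK.
by have := ltn_ord i; have := ltn_ord j; lia.
Qed.

End Bruhat.

Section MultiplicityOne.

Variables (F : finFieldType) (C : numFieldType) (psi : F -> C).
Hypothesis psiP : nontrivial_character psi.

Let psi0 : psi 0 = 1. Proof. by case: psiP. Qed.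
Let psiD x y : psi (x + y) = psi x * psi y. Proof. by case: psiP => _ ->. Qed.

Variables (m d : nat) (rho : 'M[F]_m -> 'M[C]_d).
Hypothesis rhoM : forall A B, rho (A *m B) = rho A *m rho B.
Local Notation su := (strict_upper F m).

Definition whittaker_idem : 'M[C]_d :=
  average psi rho (@nat_of_ord m) (@superdiag F m).
Local Notation e := whittaker_idem.

(** As A varies, these operators span the corner cut out by e of the enveloping
    algebra of rho. *)
Definition bessel A := e *m rho A *m e.

Lemma bessel_mull x A : x \in su ->
  bessel ((1%:M + x) *m A) = psi (superdiag x) *: bessel A.
Proof.
move=> xs; rewrite /bessel rhoM mulmxA.
rewrite (average_mulr psiP rhoM (@superdiagD F m) (@superdiagM F m) xs).
by rewrite -!scalemxAl.
Qed.

Lemma bessel_mulr x A : x \in su ->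
  bessel (A *m (1%:M + x)) = psi (superdiag x) *: bessel A.
Proof.
move=> xs; rewrite /bessel rhoM -!mulmxA.
by rewrite (average_mull psiP rhoM (@superdiagD F m) (@superdiagM F m) xs) -!scalemxAr.
Qed.

Lemma superdiag_delta (i j : 'I_m) (t : F) :
  superdiag (t *: delta_mx i j) = if j == i.+1 :> nat then t else 0.
Proof.
rewrite /superdiag (bigD1 i) //= [X in _ + X]big1 ?addr0 => [|k ki]; last first.
  by rewrite big1 // => l _; rewrite !mxE (negbTE ki) mulr0.
rewrite big_mkcond (bigD1 j) //= [X in _ + X]big1 ?addr0 => [|l lj].
  by rewrite !mxE !eqxx mulr1.
by rewrite !mxE (negbTE lj) andbF mulr0 if_same.
Qed.

Lemma delta_strict_upper (i j : 'I_m) (t : F) : (i < j)%N -> t *: delta_mx i j \in su.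
Proof.
move=> ij; apply/strict_upperP => k l lk; rewrite !mxE.
case: eqP => [ki|]; case: eqP => [lj|]; rewrite ?mulr0 //.
by move: ij; rewrite -ki -lj ltnNge lk.
Qed.

(** For w j < w (j + 1) the root subgroup of (j, j + 1) is carried by the monomial
    matrix M to that of (w j, w (j + 1)), again upper triangular. The generic
    character must agree on both, which forces the second root to be simple
    and the two entries of M to be equal. *)
Lemma monomial_step (w : 'I_m -> 'I_m) (D : 'I_m -> F) (j j' : 'I_m) :
    injective w -> (forall j, D j != 0) -> bessel (monomial_mx w D) != 0 ->
    j' = j.+1 :> nat -> (w j < w j')%N ->
  w j' = (w j).+1 :> nat /\ D j = D j'.
Proof.
move=> wI D0 nz jj' lt; set M := monomial_mx w D in nz *.
(* As M x = z M, the operator bessel M is multiplied by the same scalar when M is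
   replaced by M (1 + x) and by (1 + z) M. *)
have key t : psi t = psi (if w j' == (w j).+1 :> nat then t * (D j / D j') else 0).
  pose x : 'M[F]_m := t *: delta_mx j j'.
  pose z : 'M[F]_m := (t * (D j / D j')) *: delta_mx (w j) (w j').
  have xs : x \in su by apply: delta_strict_upper; rewrite jj'.
  have zs : z \in su by exact: delta_strict_upper.
  have Mx : M *m x = z *m M.
    rewrite -scalemxAr -scalemxAl; apply/matrixP => a b.
    rewrite [LHS]mxE [RHS]mxE [X in t * X = _]mxE [X in _ = _ * X]mxE.
    rewrite (bigD1 j) //= big1 => [|k kj]; last first.
      by rewrite [X in _ * X]mxE (negbTE kj) mulr0.
    rewrite (bigD1 (w j')) //= big1 => [|k kj]; last first.
      by rewrite [X in X * _]mxE (negbTE kj) andbF mul0r.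
    rewrite !mxE !eqxx /= !addr0 andbT (inj_eq wI) (eq_sym j').
    case: (a =P w j) => [_|]; last by rewrite !(mul0r, mulr0).
    case: (b =P j') => [->|]; last by rewrite !mulr0.
    by rewrite mulr1 mul1r -mulrA divfK.
  have := bessel_mulr M xs; rewrite mulmxDr mulmx1 Mx.
  have -> : M + z *m M = (1%:M + z) *m M by rewrite mulmxDl mul1mx.
  rewrite bessel_mull // !superdiag_delta jj' eqxx => /eqP.
  by rewrite -subr_eq0 -scalerBl scaler_eq0 (negbTE nz) orbF subr_eq0 => /eqP ->.
have [_ _ [t0 nt0]] := psiP.
have wj : w j' = (w j).+1 :> nat.
  by apply/eqP; apply: contraNT nt0 => /negbTE wn; rewrite key wn psi0.
split=> //; move: key; rewrite wj eqxx => key.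
apply/eqP; apply: contraT => Dn.
have a0 : D j / D j' - 1 != 0.
  by rewrite subr_eq0; apply: contraNneq Dn => h; rewrite -[D j](divfK (D0 j')) h mul1r.
have [t] := character_scale_neq1 psiP a0.
by rewrite mulrBr mulr1 psiD -key (psiVN psiP) eqxx.
Qed.

(** By [monomial_step], j |-> m - 1 - w j descends only by one, with constant
    entries along a descent, so [descent_involution] applies; the involution
    property is the invariance of the matrix under [antitranspose]. *)
Lemma monomial_antitranspose (w : 'I_m -> 'I_m) (D : 'I_m -> F) :
    injective w -> (forall j, D j != 0) -> bessel (monomial_mx w D) != 0 ->
  antitranspose (monomial_mx w D) = monomial_mx w D.
Proof.
move=> wI D0 nz.
case: (posnP m) => [m0 | m_gt0].
  apply/matrixP => i; have im := leq_ltn_trans (leq0n i) (ltn_ord i).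
  by exfalso; move: im; rewrite m0.
pose o k := insubd (Ordinal m_gt0) k.
have oE k : (k < m)%N -> o k = k :> nat by move=> km; rewrite /o val_insubd km.
have oK (i : 'I_m) : o i = i by apply: ord_inj; rewrite oE.
pose f k : nat := rev_ord (w (o k)); pose Df k := D (o k).
have vI : injective (fun j => rev_ord (w j)) by move=> a b /rev_ord_inj /wI.
have inv (j : 'I_m) : f (f j) = j /\ Df (f j) = Df j.
  apply: (@descent_involution _ m) => //.
  - by move=> k _; exact: ltn_ord.
  - by move=> k l km lm /val_inj /vI /(congr1 (@nat_of_ord m)); rewrite !oE.
  - move=> y ym; have [g _ gK] := injF_bij vI.
    exists (g (Ordinal ym)) => //; by rewrite /f oK gK.
  move=> k km lt; have := @monomial_step w D (o k) (o k.+1) wI D0 nz.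
  have ow := ltn_ord (w (o k)); have ow' := ltn_ord (w (o k.+1)).
  rewrite !oE //; last exact: ltnW.
  move: lt; rewrite /f /= => lt /(_ erefl) h.
  by have [|h1 Dk] := h; [lia | split; [lia | exact: Dk]].
have v2 (j : 'I_m) : rev_ord (w (rev_ord (w j))) = j /\ D (rev_ord (w j)) = D j.
  have [h1 h2] := inv j; rewrite /Df /f !oK in h1 h2; split=> //; exact: val_inj.
apply/matrixP => i j; rewrite !mxE.
have wE : (rev_ord j == w (rev_ord i)) = (i == w j).
  rewrite -(inj_eq rev_ord_inj) rev_ordK.
  apply/eqP/eqP => [ji | ->]; last by have [] := v2 j.
  have [h _] := v2 (rev_ord i); rewrite -ji in h.
  by apply: rev_ord_inj.
rewrite wE; case: eqP => // ij; by have [_ <-] := v2 j; rewrite ij.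
Qed.

Lemma antitranspose_monomial (w : 'I_m -> 'I_m) (D : 'I_m -> F) :
    injective w -> (forall j, D j != 0) -> exists w' D',
  [/\ injective w', forall j, D' j != 0 &
      antitranspose (monomial_mx w D) = monomial_mx w' D'].
Proof.
move=> wI D0; pose w' (j : 'I_m) := rev_ord (invF wI (rev_ord j)).
exists w', (fun j => D (rev_ord (w' j))); split=> //.
  by move=> a b /rev_ord_inj /(can_inj (f_invF wI)) /rev_ord_inj.
apply/matrixP => i j; rewrite !mxE.
have -> : (rev_ord j == w (rev_ord i)) = (i == w' j).
  rewrite -(inj_eq rev_ord_inj i) rev_ordK -(inj_eq wI (rev_ord i)) f_invF.
  exact: eq_sym.
by case: eqP => // ->.
Qed.

(** Gelfand's trick: both sides transform alike under the unitriangular group,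
    so it is enough to treat a monomial matrix M. There, either both sides
    vanish, or one of M and its antitranspose is fixed. *)
Lemma bessel_antitranspose A : A \in unitmx -> bessel (antitranspose A) = bessel A.
Proof.
move=> uA; have [x [y [w [D [xs ys wI D0 ME]]]]] := bruhat uA.
set M := monomial_mx w D in ME.
have uM : M \in unitmx by rewrite -ME !unitmx_mul uA !strict_upper_unit.
pose c := psi (superdiag x) * psi (superdiag y).
have c0 : c != 0.
  apply/negP; rewrite mulf_eq0 => /orP[] /eqP h.
    by have /eqP := psiVN psiP (superdiag x); rewrite h mul0r eq_sym oner_eq0.
  by have /eqP := psiVN psiP (superdiag y); rewrite h mul0r eq_sym oner_eq0.
have EM : bessel M = c *: bessel A.
  by rewrite -ME bessel_mulr // bessel_mull // scalerA mulrC.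
have EM' : bessel (antitranspose M) = c *: bessel (antitranspose A).
  rewrite -ME !antitransposeM !antitransposeD !antitranspose1.
  rewrite bessel_mull ?antitranspose_strict_upper //.
  by rewrite bessel_mulr ?antitranspose_strict_upper // !superdiag_antitranspose scalerA mulrC.
suff E : bessel (antitranspose M) = bessel M.
  by apply: (scalerI c0); rewrite -EM -EM'.
have [Mz | Mnz] := eqVneq (bessel M) 0; last by rewrite monomial_antitranspose.
have [-> // | M'nz] := eqVneq (bessel (antitranspose M)) 0.
have [w' [D' [w'I D'0 M'E]]] := antitranspose_monomial wI D0.
rewrite -/M in M'E; rewrite M'E in M'nz.
by have := monomial_antitranspose w'I D'0 M'nz; rewrite -M'E antitransposeK => <-.
Qed.

Hypothesis rho_span : forall B : 'M[C]_d, exists c : 'M[F]_m -> C,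
  B = \sum_(A | A \in unitmx) c A *: rho A.

(** bessel A * bessel B is an average of bessel (A u B), and the
    antitranspose exchanges the roles of A and B in it. *)
Lemma bessel_commute A B : A \in unitmx -> B \in unitmx ->
  bessel A *m bessel B = bessel B *m bessel A.
Proof.
move=> uA uB.
have ee : e *m e = e.
  exact: (average_idempotent psiP rhoM (@superdiagD F m) (@superdiagM F m)).
have mid X Y : X *m e *m Y = #|su|%:R^-1 *:
    \sum_(x in su) psi (- superdiag x) *: (X *m rho (1%:M + x) *m Y).
  rewrite -scalemxAr -scalemxAl mulmx_sumr mulmx_suml; congr (_ *: _).
  by apply: eq_bigr => x _; rewrite -scalemxAr -scalemxAl.
have E A1 B1 : bessel A1 *m bessel B1 = #|su|%:R^-1 *:
    \sum_(x in su) psi (- superdiag x) *: bessel (A1 *m (1%:M + x) *m B1).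
  have -> : bessel A1 *m bessel B1 = (e *m rho A1) *m e *m (rho B1 *m e).
    by rewrite /bessel !mulmxA -(mulmxA _ e e) ee.
  rewrite mid; congr (_ *: _).
  by apply: eq_bigr => x _; rewrite /bessel !rhoM !mulmxA.
rewrite -[in RHS](bessel_antitranspose uA) -[in RHS](bessel_antitranspose uB) !E.
congr (_ *: _); rewrite -[RHS](sum_in_inj _ (can_inj (@antitransposeK F m))); last first.
  by move=> x; exact: antitranspose_strict_upper.
apply: eq_bigr => x xs; rewrite superdiag_antitranspose; congr (_ *: _).
rewrite -bessel_antitranspose ?unitmx_mul ?uA ?uB ?strict_upper_unit //.
by rewrite !antitransposeM antitransposeD antitranspose1 mulmxA.
Qed.

Lemma whittaker_rank_le1 : (\rank e <= 1)%N.
Proof.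
have ee : e *m e = e.
  exact: (average_idempotent psiP rhoM (@superdiagD F m) (@superdiagM F m)).
apply: (rank_commutative_corner ee) => X Y.
have [c ->] := rho_span X; have [c' ->] := rho_span Y.
have L (c1 c2 : 'M[F]_m -> C) :
    e *m (\sum_(A | A \in unitmx) c1 A *: rho A) *m e *m
      (\sum_(B | B \in unitmx) c2 B *: rho B) *m e =
    \sum_(A | A \in unitmx) \sum_(B | B \in unitmx)
      (c1 A * c2 B) *: (bessel A *m bessel B).
  rewrite [e *m \sum_(A | _) _]mulmx_sumr !mulmx_suml; apply: eq_bigr => A _.
  rewrite mulmx_sumr mulmx_suml; apply: eq_bigr => B _.
  rewrite /bessel; move: whittaker_idem ee => e0 ee0.
  rewrite -!scalemxAr -!scalemxAl scalerA mulrC.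
  by rewrite !mulmxA -(mulmxA _ e0 e0) ee0.
rewrite !L exchange_big /=; apply: eq_bigr => B uB; apply: eq_bigr => A uA.
by rewrite bessel_commute // mulrC.
Qed.

End MultiplicityOne.

(** * Representations of GL as multiplicative functions of matrices *)
Section MatrixExtension.

Variables (F : finFieldType) (K : numFieldType) (k d : nat).
Variable pi : mx_representation K 'GL_k[F] d.

Definition GL_of (A : 'M[F]_k.-1.+1) : {'GL_k[F]} := insubd (1%g : {'GL_k[F]}) A.

Lemma GL_ofK A : A \in unitmx -> GLval (GL_of A) = A.
Proof. by move=> uA; exact: (insubdK (1%g : {'GL_k[F]}) uA). Qed.

Lemma GLvalK (u : {'GL_k[F]}) : GL_of (GLval u) = u.
Proof. by apply: val_inj; exact: GL_ofK (GL_unitmx u). Qed.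

(** Extending by 0 on singular matrices keeps multiplicativity and allows
    additive changes of variables without tracking invertibility. *)
Definition extend_repr (A : 'M[F]_k.-1.+1) : 'M[K]_d :=
  if A \in unitmx then pi (GL_of A) else 0.

Lemma extend_reprE (u : {'GL_k[F]}) : extend_repr (GLval u) = pi u.
Proof. by rewrite /extend_repr GL_unitmx GLvalK. Qed.

Lemma extend_repr1 : extend_repr 1%:M = 1%:M.
Proof. by have := extend_reprE 1%g; rewrite repr_mx1. Qed.

Lemma extend_reprM A B : extend_repr (A *m B) = extend_repr A *m extend_repr B.
Proof.
rewrite /extend_repr unitmx_mul.
case: (boolP (A \in unitmx)) => uA /=; last by rewrite mul0mx.
case: (boolP (B \in unitmx)) => uB /=; last by rewrite mulmx0.
rewrite -repr_mxM ?inE //; congr (pi _); apply: val_inj.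
rewrite [RHS]GL_MxE [LHS]GL_ofK ?unitmx_mul ?uA //.
by congr (_ *m _); rewrite [RHS]GL_ofK.
Qed.

Lemma extend_repr_span : mx_absolutely_irreducible pi ->
  forall B : 'M[K]_d, exists c : 'M[F]_k.-1.+1 -> K,
    B = \sum_(A | A \in unitmx) c A *: extend_repr A.
Proof.
move=> /mx_abs_irrP[_ [a aE]] B; exists (fun A => a (GL_of A) B).
rewrite {1}(aE B) [RHS](reindex_onto (fun u : {'GL_k[F]} => GLval u) GL_of).
  apply: eq_big => [u|u _]; first by rewrite inE GL_unitmx GLvalK eqxx.
  by rewrite GLvalK extend_reprE.
by move=> A uA; exact: GL_ofK.
Qed.

Lemma std_unip_radicalE sh (u : {'GL_k[F]}) :
  (u \in std_unip_radical F k sh) =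
  (GLval u - 1%:M \in nilradical (fun i : 'I_k.-1.+1 => reshape_index sh i)).
Proof.
rewrite inE; apply/forallP/nilradicalP => [h i j le | h i].
  by move/forallP: (h i) => /(_ j)/implyP/(_ le)/eqP; rewrite !mxE => ->; rewrite subrr.
apply/forallP => j; apply/implyP => le; have := h i j le.
by rewrite !mxE => /eqP; rewrite subr_eq0.
Qed.

(** The average over a group projects onto its fixed vectors; it is [average]
    for lam = 0. *)
Lemma sum_extend_repr_cuspidal (psi : F -> K) sh :
    nontrivial_character psi ->
    rfix_mx pi (std_unip_radical F k sh) = 0 ->
  \sum_(z in nilradical (fun i : 'I_k.-1.+1 => reshape_index sh i)) extend_repr (1%:M + z) = 0.
Proof.
move=> psiP fix0; set beta := fun i : 'I_k.-1.+1 => _; set S := \sum_(z in _) _.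
pose av := average psi extend_repr beta (fun=> 0).
have psi0 : psi 0 = 1 by case: psiP.
have avS : av = #|@nilradical F _ beta|%:R^-1 *: S.
  rewrite /av /average; congr (_ *: _); apply: eq_bigr => x _.
  by rewrite oppr0 psi0 scale1r.
have l0 : {morph (fun _ : 'M[F]_k.-1.+1 => 0 : F) : x y / x + y}.
  by move=> x y; rewrite addr0.
have : (av <= rfix_mx pi (std_unip_radical F k sh))%MS.
  apply/rfix_mxP => u; rewrite std_unip_radicalE => uL.
  have := average_mulr psiP extend_reprM l0 _ uL.
  by rewrite subrKC extend_reprE psi0 scale1r; exact.
rewrite fix0 submx0 avS scaler_eq0 invr_eq0 (negbTE (card_nilradical_neq0 _ _ _)) => /eqP //.
Qed.

End MatrixExtension.

Lemma reshape_index_cat2 a b i : (i < a + b)%N -> reshape_index [:: a; b] i = (a <= i)%N.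
Proof.
move=> iab; case: (leqP a i) => ai.
  rewrite -[in LHS](subnKC ai) -[X in (X + _)%N](addn0 a).
  apply: (@flatten_indexKl [:: a; b] 1 (i - a)) => /=; lia.
exact: (@flatten_indexKl [:: a; b] 0 i).
Qed.

Lemma sum_cuspidal_nilradical2 (R : realType) (F : finFieldType) k d (psi : F -> R[i])
    (pi : mx_representation R[i] 'GL_k[F] d) a :
    nontrivial_character psi -> cuspidal pi -> (0 < a <= k.-1)%N ->
  \sum_(z in nilradical2 F k.-1.+1 a) extend_repr pi (1%:M + z) = 0.
Proof.
move=> psiP cP /andP[a0 ak].
have := @sum_extend_repr_cuspidal F _ k d pi psi [:: a; (k - a)%N] psiP.
rewrite -[std_unip_radical _ _ _]conjsg1 cP //; last first.
  rewrite /composition !inE /= addn0 subnKC ?eqxx; lia.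
move=> /(_ erefl) S0; rewrite -[RHS]S0; apply: eq_bigl => z; rewrite /nilradical2.
have E (i : 'I_k.-1.+1) : reshape_index [:: a; (k - a)%N] i = (a <= i)%N.
  by apply: reshape_index_cat2; have := ltn_ord i; lia.
by apply/nilradicalP/nilradicalP => h i j le; apply: h; rewrite ?E // -?E.
Qed.

(** [cuspfunE] gives this up to the factor rank e, the multiplicity of the
    generic character. It is at most 1 by [whittaker_rank_le1], and not 0
    because the formula at x = 0 gives the dimension d > 0. *)
Lemma cuspidal_trace (R : realType) (F : finFieldType) k d (psi : F -> R[i])
    (pi : mx_representation R[i] 'GL_k[F] d) :
    nontrivial_character psi -> mx_irreducible pi -> cuspidal pi ->
  forall x : 'M[F]_k.-1.+1, nilpotentmx x -> (forall i, x i 0 = 0) ->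
  \tr (extend_repr pi (1%:M + x)) = unip_value F R[i] k.-1.+1 (\rank x).
Proof.
move=> psiP pi_irr cP.
have absP : mx_absolutely_irreducible pi.
  exact: (@group_closure_closed_field R[i] _ _ _ pi pi_irr).
have rhoM := @extend_reprM F R[i] k d pi.
have rho1 := extend_repr1 pi.
have Phi := cuspidal_cuspfun rhoM (fun a ha => sum_cuspidal_nilradical2 psiP cP ha).
pose e := whittaker_idem psi (extend_repr pi).
have wE : whittaker psi (fun x => \tr (extend_repr pi (1%:M + x))) = (\rank e)%:R.
  rewrite (whittakerE psiP) /e /whittaker_idem.
  rewrite (rank_average psiP rhoM) //.
  - exact: superdiagD.
  - exact: superdiagM.
have trE x : nilpotentmx x -> (forall i, x i 0 = 0) -> \tr (extend_repr pi (1%:M + x)) =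
    unip_value F R[i] k.-1.+1 (\rank x) * (\rank e)%:R.
  move=> nx x0; rewrite -wE; rewrite [x](mirab_of_col0 x0) in nx *.
  by rewrite (cuspfunE psiP _ Phi) //; move/nilpotentmx_mirab: nx.
have e1 : (\rank e <= 1)%N.
  by apply: (whittaker_rank_le1 psiP rhoM); exact: extend_repr_span.
have d0 : (0 < d)%N by case/mx_abs_irrP: absP.
have e_neq0 : \rank e != 0%N.
  apply/eqP => e0; have := trE 0; rewrite e0 mulr0 addr0 rho1 mxtrace1 => h.
  have : (d%:R : R[i]) = 0.
    by apply: h => [|i]; [exists 1%N; rewrite expr1 | rewrite mxE].
  by move/eqP; rewrite pnatr_eq0 -leqn0 leqNgt d0.
have {}e1 : \rank e = 1%N by lia.
by move=> x nx x0; rewrite trE // e1 mulr1.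
Qed.

(** * The sum over the unipotent radical of type (n, n, n) *)
Section ThreeBlocks.

Variables (F : finFieldType) (n : nat).
Hypothesis n_gt0 : (0 < n)%N.
Local Notation m := (3 * n).-1.+1.

Lemma row_dim : (n + n + n)%N = m. Proof. lia. Qed.
Lemma col_dim : (n + (n + n))%N = m. Proof. lia. Qed.

Definition beta3 (i : 'I_m) : nat := reshape_index [:: n; n; n] i.

Lemma reshape_index3 a c : (a < 3)%N -> (c < n)%N ->
  reshape_index [:: n; n; n] (a * n + c) = a.
Proof.
move=> a3 cn; have := @flatten_indexKl [:: n; n; n] a c.
rewrite /flatten_index; case: a a3 => [|[|[|//]]] _ /= => [/(_ cn)|/(_ cn)|/(_ cn)] H;
  rewrite -[RHS]H; congr reshape_index; lia.
Qed.

(** The matrix (0 X Y; 0 0 Z; 0 0 0), with A = (X Y). *)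
Definition nilradical3_mx (A : 'M[F]_(n, n + n)) (Z : 'M[F]_n) : 'M[F]_m :=
  castmx (row_dim, col_dim)
    (block_mx (0 : 'M_(n + n, n)) (col_mx A (row_mx 0 Z)) 0 0).

Definition row_idx a (i : 'I_n) : 'I_m := inord (a * n + i).

Lemma row_idxE a i : (a < 3)%N -> row_idx a i = (a * n + i)%N :> nat.
Proof. by move=> a3; rewrite inordK //; have := ltn_ord i; nia. Qed.

Lemma beta3_row_idx a i : (a < 3)%N -> beta3 (row_idx a i) = a.
Proof. by move=> a3; rewrite /beta3 row_idxE // reshape_index3. Qed.

Lemma row_idxP (i : 'I_m) : exists a (i' : 'I_n), (a < 3)%N /\ i = row_idx a i'.
Proof.
have im := ltn_ord i.
have a3 : (i %/ n < 3)%N by rewrite ltn_divLR //; lia.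
have i'n : (i %% n < n)%N by rewrite ltn_mod.
exists (i %/ n)%N, (Ordinal i'n); split=> //.
by apply: ord_inj; rewrite row_idxE //= -divn_eq.
Qed.

Lemma nilradical3E A Z a b (i j : 'I_n) : (a < 3)%N -> (b < 3)%N ->
  nilradical3_mx A Z (row_idx a i) (row_idx b j) =
  match a, b with
  | 0, 1 => A i (lshift n j)
  | 0, 2 => A i (rshift n j)
  | 1, 2 => Z i j
  | _, _ => 0
  end.
Proof.
move=> a3 b3; rewrite castmxE.
have rowE : cast_ord (esym row_dim) (row_idx a i) =
    match a with 0 => lshift n (lshift n i) | 1 => lshift n (rshift n i)
      | _ => rshift (n + n) i end.
  apply: ord_inj; rewrite /= row_idxE //.
  by case: a a3 => [|[|[|//]]] _ /=; lia.
have colE : cast_ord (esym col_dim) (row_idx b j) =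
    match b with 0 => lshift (n + n) j | 1 => rshift n (lshift n j)
      | _ => rshift n (rshift n j) end.
  apply: ord_inj; rewrite /= row_idxE //.
  by case: b b3 => [|[|[|//]]] _ /=; lia.
rewrite rowE colE.
case: a a3 {rowE} => [|[|[|//]]] _; case: b b3 {colE} => [|[|[|//]]] _.
- by rewrite block_mxEul mxE.
- by rewrite block_mxEur col_mxEu.
- by rewrite block_mxEur col_mxEu.
- by rewrite block_mxEul mxE.
- by rewrite block_mxEur col_mxEd row_mxEl mxE.
- by rewrite block_mxEur col_mxEd row_mxEr.
- by rewrite block_mxEdl mxE.
- by rewrite block_mxEdr mxE.
- by rewrite block_mxEdr mxE.
Qed.

Lemma rank_nilradical3 A Z : \rank (nilradical3_mx A Z) = \rank (col_mx A (row_mx 0 Z)).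
Proof.
have rk (a b a' b' : nat) (e : (a = a') * (b = b')) (M : 'M[F]_(a, b)) :
    \rank (castmx e M) = \rank M.
  by case: e => e1 e2; case: a' / e1; case: b' / e2.
by rewrite rk block_mxEv row_mx0 rank_col_mx0 rank_row_0mx.
Qed.

(** The nilradical of type (n, n, n) is parametrized by A = (X Y) and Z. *)
Lemma sum_nilradical3 (V : nmodType) (G : 'M[F]_m -> V) :
  \sum_(x in nilradical beta3) G x =
  \sum_(Z : 'M[F]_n) \sum_(A : 'M[F]_(n, n + n)) G (nilradical3_mx A Z).
Proof.
rewrite pair_big /=.
pose inv (x : 'M[F]_m) : 'M[F]_n * 'M[F]_(n, n + n) :=
  (\matrix_(i, j) x (row_idx 1 i) (row_idx 2 j),
   row_mx (\matrix_(i, j) x (row_idx 0 i) (row_idx 1 j))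
          (\matrix_(i, j) x (row_idx 0 i) (row_idx 2 j))).
rewrite (reindex_onto (fun p : 'M[F]_n * 'M[F]_(n, n + n) => nilradical3_mx p.2 p.1) inv) /=.
  apply: eq_bigl => -[Z A] /=.
  have -> : nilradical3_mx A Z \in nilradical beta3.
    apply/nilradicalP => i j; have [a [i' [a3 ->]]] := row_idxP i.
    have [b [j' [b3 ->]]] := row_idxP j.
    rewrite !beta3_row_idx // nilradical3E //.
    by case: a a3 => [|[|[|//]]] _; case: b b3 => [|[|[|//]]] _.
  apply/eqP; rewrite /inv; congr (_, _).
    by apply/matrixP => i j; rewrite mxE nilradical3E.
  apply/matrixP => i j; rewrite -(splitK j); case: (split j) => j' /=.
    by rewrite row_mxEl mxE nilradical3E.
  by rewrite row_mxEr mxE nilradical3E.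
move=> x /nilradicalP xb; apply/matrixP => i j.
have [a [i' [a3 ->]]] := row_idxP i; have [b [j' [b3 ->]]] := row_idxP j.
rewrite nilradical3E //.
case: a a3 => [|[|[|//]]] _; case: b b3 => [|[|[|//]]] _;
  by rewrite ?row_mxEl ?row_mxEr ?mxE // xb // !beta3_row_idx.
Qed.

Definition trace3 (x : 'M[F]_m) : F :=
  \tr (\matrix_(i < n, j < n) x (row_idx 0 i) (row_idx 1 j) +
       \matrix_(i < n, j < n) x (row_idx 1 i) (row_idx 2 j)).

Lemma trace3E x : trace3 x =
  \sum_(i < n) (x (row_idx 0 i) (row_idx 1 i) + x (row_idx 1 i) (row_idx 2 i)).
Proof. by apply: eq_bigr => i _; rewrite !mxE. Qed.

Lemma trace3D : {morph trace3 : x y / x + y}.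
Proof.
move=> x y; rewrite !trace3E -big_split; apply: eq_bigr => i _ /=.
by rewrite !mxE addrACA.
Qed.

Lemma trace3M : {in nilradical beta3 &, forall x y, trace3 (x *m y) = 0}.
Proof.
move=> x y /nilradicalP xb /nilradicalP yb; rewrite trace3E big1 // => i _.
have H a : (a < 2)%N -> (x *m y) (row_idx a i) (row_idx a.+1 i) = 0.
  move=> a2; rewrite mxE big1 // => l _.
  case: (leqP (beta3 l) (beta3 (row_idx a i))) => [le | lt]; first by rewrite xb ?mul0r.
  rewrite yb ?mulr0 //; move: lt; rewrite !beta3_row_idx //; exact: ltnW.
by rewrite !H // addr0.
Qed.

Lemma trace3_nilradical3 A Z : trace3 (nilradical3_mx A Z) = \tr (lsubmx A) + \tr Z.
Proof.
rewrite trace3E big_split /=; congr (_ + _); apply: eq_bigr => i _.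
  by rewrite nilradical3E // mxE.
by rewrite nilradical3E.
Qed.

Lemma trace3_1 x : trace3 (1%:M + x) = trace3 x.
Proof.
rewrite !trace3E; apply: eq_bigr => i _.
have H a b : (a < 3)%N -> (b < 3)%N -> a != b -> (row_idx a i == row_idx b i) = false.
  move=> a3 b3; apply: contraNF => /eqP/(congr1 beta3); rewrite !beta3_row_idx // => ->.
  by [].
by rewrite !mxE !H // !add0r.
Qed.

Variables (C : numFieldType) (psi : F -> C).
Hypothesis psiP : nontrivial_character psi.

(** [sum_unip_value_block] when there is nothing but the square block. *)
Lemma sum_unip_value_square :
  \sum_(Z : 'M[F]_n) unip_value F C (2 * n) (\rank Z) * psi (\tr Z) =
  (#|F| ^ (\sum_(i < n) (2 * n - i.+1)))%:R * unip_value F C n 0.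
Proof.
have h : (n + 0 < 2 * n)%N by lia.
have := sum_unip_value_block psiP (0 : 'M[F]_(0, 0)) h.
rewrite mxrank0 mulSn mul1n addnK => <-.
pose up (Z : 'M[F]_n) : 'M[F]_(n, n + 0) := row_mx Z 0.
rewrite [RHS](reindex_onto up lsubmx); last first.
  by move=> A _; rewrite -[RHS]hsubmxK /up; congr row_mx; apply/matrixP => i [].
apply: eq_big => [Z | Z _]; first by rewrite /up row_mxKl eqxx.
rewrite /up row_mxKl; congr (unip_value _ _ _ _ * _).
by rewrite row_mx0 rank_col_mx0 rank_row_mx0.
Qed.

(** First the rows of (X Y) are removed, for fixed Z, then those of Z. *)
Lemma sum_unip_value_nilradical3 :
  \sum_(x in nilradical beta3) unip_value F C (3 * n) (\rank x) * psi (trace3 x) =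
  (#|F| ^ (4 * (n * n) - n))%:R * unip_value F C n 0.
Proof.
rewrite sum_nilradical3.
transitivity (\sum_(Z : 'M[F]_n) (#|F| ^ (\sum_(i < n) (3 * n - i.+1)))%:R *
    (unip_value F C (2 * n) (\rank Z) * psi (\tr Z))).
  apply: eq_bigr => Z _.
  have h : (n + n < 3 * n)%N by lia.
  have := sum_unip_value_block psiP Z h.
  have -> : (3 * n - n = 2 * n)%N by lia.
  rewrite mulrA => <-; rewrite mulr_suml; apply: eq_bigr => A _.
  rewrite rank_nilradical3 trace3_nilradical3 -mulrA; congr (_ * _).
  by case: psiP => _ ->.
rewrite -mulr_sumr sum_unip_value_square mulrA -natrM -expnD; congr ((_ ^ _)%:R * _).
(* Each exponent of q is n (c - 1) - n (n - 1) / 2, for c = 3n and c = 2n. *)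
have E c : (n <= c)%N -> (\sum_(i < n) (c - i.+1) + \sum_(i < n) i = n * (c - 1))%N.
  move=> nc; rewrite -big_split /= (eq_bigr (fun=> (c - 1)%N)).
    by rewrite sum_nat_const card_ord.
  by move=> i _; have := ltn_ord i; lia.
have := E (3 * n)%N ltac:(lia); have := E (2 * n)%N ltac:(lia).
have := bin2_sum n; rewrite bin2 big_mkord => ->.
have := divn_eq (n * n.-1) 2.
have : ((n * n.-1) %% 2 = 0)%N.
  by rewrite modn2 oddM; case: (n) => //= k; rewrite andNb.
rewrite -divn2; nia.
Qed.

End ThreeBlocks.

Lemma card_beta3 (F : finFieldType) n : (0 < n)%N ->
  #|@nilradical F _ (@beta3 n)| = (#|F| ^ (3 * (n * n)))%N.
Proof.
move=> n_gt0; rewrite -sum1_card (@sum_nilradical3 F n n_gt0 nat).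
rewrite sum_nat_const sum_nat_const muln1 !cardT -!cardE !card_mx -expnD.
by congr (_ ^ _)%N; lia.
Qed.

(** Both row spaces consist of the vectors on which N acts through psi. *)
Lemma twisted_jacquet_average (R : realType) (F : finFieldType) n d
    (pi : mx_representation R[i] 'GL_(3 * n)[F] d) (psi0 : F -> R[i]) :
    (0 < n)%N -> nontrivial_character psi0 ->
  \rank (twisted_jacquet pi psi0) =
  \rank (average psi0 (extend_repr pi) (@beta3 n) (@trace3 F n)).
Proof.
move=> n_gt0 psiP; set av := average _ _ _ _.
have rhoM := @extend_reprM F R[i] (3 * n) d pi.
have tM := trace3M n_gt0 (F := F).
have tD := @trace3D F n.
have uE (u : {'GL_(3 * n)[F]}) : pi u = extend_repr pi (1%:M + (GLval u - 1%:M)).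
  by rewrite subrKC extend_reprE.
have psiE (u : {'GL_(3 * n)[F]}) : psi3 psi0 u = psi0 (trace3 (GLval u - 1%:M)).
  by rewrite -(trace3_1 n_gt0) subrKC.
suff /eqmx_rank -> : (twisted_jacquet pi psi0 == av)%MS by [].
apply/andP; split.
  set W := twisted_jacquet pi psi0; have <- : W *m av = W; last exact: submxMl.
  apply: (average_fixed psiP) => x xL.
  have ux : 1%:M + x \in unitmx by apply/nilpotentmx_unit/(nilradical_nilpotent xL).
  pose u := @GL_of F (3 * n) (1%:M + x).
  have xE : GLval u - 1%:M = x by rewrite GL_ofK // addrC addKr.
  have uN : u \in N3 F n by rewrite std_unip_radicalE xE.
  have /sub_bigcapmxP/(_ u uN)/eigenspaceP := submx_refl W.
  by rewrite uE psiE xE.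
apply/sub_bigcapmxP => u uN; apply/eigenspaceP; rewrite uE psiE.
apply: (average_mulr psiP rhoM tD tM).
by rewrite -std_unip_radicalE.
Qed.

(** The factor q^i is taken out of q^n - q^i, and i replaced by n - i. *)
Lemma prod_expn_sub q n :
  (\prod_(1 <= i < n) (q ^ n - q ^ i) =
   q ^ ((n * (n - 1)) %/ 2) * \prod_(1 <= i < n) (q ^ i - 1))%N.
Proof.
case: n => [|n]; first by rewrite !big_geq.
rewrite !big_add1 /= !big_mkord.
rewrite (eq_bigr (fun i : 'I_n => (q ^ i.+1 * (q ^ (n - i) - 1))%N)) => [|i _].
  rewrite big_split /= -expn_sum; congr (_ ^ _ * _)%N.
    rewrite -(big_mkord xpredT (fun i => i.+1)) -(big_add1 _ _ 0 n.+1 xpredT id) /=.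
    have := bin2_sum n.+1; rewrite big_nat_recl // bin2 add0n big_add1 /= => ->.
    by rewrite subn1 divn2.
  rewrite [RHS](reindex_inj rev_ord_inj) /=; apply: eq_bigr => i _.
  by rewrite subnSK.
rewrite mulnBr muln1 -expnD; congr (_ ^ _ - _)%N.
by have := ltn_ord i; lia.
Qed.

Theorem theorem1 (R : realType) (F : finFieldType) (q n : nat) (hq : #|F| = q)
    (hn : (0 < n)%N) (d : nat) (pi : mx_representation R[i] 'GL_(3 * n)[F] d)
    (pi_irr : mx_irreducible pi) (pi_cusp : cuspidal pi)
    (psi0 : F -> R[i]) (psi0_char : additive_character psi0)
    (psi0_nontriv : exists x : F, psi0 x <> 1) :
  \rank (twisted_jacquet pi psi0) =
    (q ^ ((n * (n - 1)) %/ 2) * \prod_(1 <= i < n) (q ^ n - q ^ i))%N.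
Proof.
have psiP : nontrivial_character psi0.
  by case: psi0_char => ? ?; split=> //; case: psi0_nontriv => x /eqP; exists x.
have k_gt0 : (0 < 3 * n)%N by lia.
have q_gt0 : (0 < q)%N by rewrite -hq; apply/card_gt0P; exists 0.
rewrite (twisted_jacquet_average pi hn psiP).
have rhoM := @extend_reprM F R[i] (3 * n) d pi.
have := rank_average psiP rhoM (@trace3D F n) (trace3M hn (F := F)).
set r := \rank _; rewrite card_beta3 // hq.
rewrite (eq_bigr (fun x => unip_value F R[i] (3 * n) (\rank x) * psi0 (- trace3 x))).
  rewrite (sum_unip_value_nilradical3 hn (nontrivial_characterN psiP)) hq => rE.
  have qr : (q ^ (3 * (n * n)) * r = q ^ (4 * (n * n) - n) *
     \prod_(1 <= i < n) (q ^ i - 1))%N.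
    apply/eqP; rewrite -(eqr_nat R[i]) !natrM rE mulVKf; last first.
      by rewrite pnatr_eq0 expn_eq0 negb_and -lt0n q_gt0.
    rewrite /unip_value expr0 mul1r subn0 hq natr_prod; apply/eqP; congr (_ * _).
    by apply: eq_bigr => i _; rewrite natrB // expn_gt0 q_gt0.
  rewrite prod_expn_sub mulnA -expnD.
  apply/eqP; rewrite -(eqn_pmul2l (_ : 0 < q ^ (3 * (n * n)))%N) ?expn_gt0 ?q_gt0 //.
  apply/eqP; rewrite qr [RHS]mulnA -expnD; congr (_ ^ _ * _)%N.
  have := divn_eq (n * (n - 1)) 2.
  have -> : ((n * (n - 1)) %% 2 = 0)%N.
    by rewrite modn2 oddM; case: (n) hn => //= k _; rewrite subn1 /= andNb.
  by move: (_ %/ 2)%N => t; nia.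
move=> x xL; congr (_ * _).
rewrite (cuspidal_trace psiP) //; first by congr (unip_value _ _ _ _); exact: prednK.
  exact: nilradical_nilpotent xL.
move=> i; move/nilradicalP: xL => -> //.
have -> : 0 = row_idx 0 (Ordinal hn) by apply: val_inj; rewrite /= inordK.
by rewrite beta3_row_idx.
Qed.
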